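(* Let $H$ be a strictly $2$-balanced graph. Then for every fixed $\delta>0$ there is a constant $C_0=C_0(\delta,H)>0$ such that for every $C\ge C_0$ there is a constant $c_0=c_0(C,\delta,H)>0$ such that for every $0<c\le c_0$ the following holds. For integers $k$ set $$n:=\lfloor c\,(k/\log k)^{m_2(H)}\rfloor \quad\text{and}\quad p:=C(\log k)/k .$$ Then, with probability tending to $1$ as $k\to\infty$, the random graph $G_{n,p}$ satisfies $$Y_K\le \delta\binom{k}{2}p \quad\text{and}\quad X_K\ge (1-\delta)\binom{k}{2}p$$ for all $k$-vertex subsets $K$ of the vertex set of $G_{n,p}$.
   Context: For a graph $F$ write $v_F:=|V(F)|$ and $e_F:=|E(F)|$. For a graph $H$ define $$m_2(H):=\max_{F\subseteq H}\Bigl(\mathbf 1_{\{v_F\ge 3\}}\tfrac{e_F-1}{v_F-2}+\mathbf 1_{\{F=K_2\}}\tfrac12\Bigr),$$ where the maximum is over all subgraphs $F$ of $H$. (For $v_F\le 2$ the first term is interpreted as $0$.) The graph $H$ is called strictly $2$-balanced if $m_2(H)>m_2(F)$ for all proper subgraphs $F\subsetneq H$. $G_{n,p}$ denotes the binomial random graph on $n$ vertices, in which each of the $\binom n2$ possible edges is present independently with probability $p$ (here $k$ is large enough that $p\le 1$). An $H$-copy of $G_{n,p}$ is a (not necessarily induced) subgraph of $G_{n,p}$ isomorphic to $H$. For a set $K$ of vertices, $G_{n,p}[K]$ is the induced subgraph on $K$, $X_K:=|E(G_{n,p}[K])|$ is the number of edges of $G_{n,p}$ inside $K$, and $Y_K$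 is the number of edges in $E(G_{n,p}[K])$ that are contained in some $H$-copy of $G_{n,p}$ (the $H$-copy need not lie inside $K$). *)

(* Defs.v *)
From HB Require Import structures.
From mathcomp Require Import all_boot all_order all_algebra.
From mathcomp Require Import all_classical all_reals all_analysis.
Set Implicit Arguments.
Unset Strict Implicit.
Unset Printing Implicit Defensive.
Import Order.TTheory GRing.Theory Num.Theory.
Import numFieldNormedType.Exports.
Local Open Scope ring_scope.

(* A finite simple graph whose vertices lie in the finite type [T]: a set of
   vertices together with a set of 2-element subsets of it.  The vertex set need
   not be all of [T], so that subgraphs of [G : graph T] are again in [graph T]. *)
Definition is_graph (T : finType) (G : {set T} * {set {set T}}) : bool :=
  [forall e in G.2, (e \subset G.1) && (#|e| == 2%N)].

Record graph (T : finType) := Graph {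
  graph_val : {set T} * {set {set T}};
  graph_valP : is_graph graph_val }.

HB.instance Definition _ (T : finType) := [isSub for @graph_val T].
HB.instance Definition _ (T : finType) := [Finite of graph T by <:].

Section Graphs.
Variable T : finType.
Implicit Types F G H : graph T.

Definition vset G : {set T} := (val G).1.
Definition eset G : {set {set T}} := (val G).2.

Definition subgraph F G : bool :=
  (vset F \subset vset G) && (eset F \subset eset G).

Definition proper_subgraph F G : bool := subgraph F G && (F != G).

Section Density.
Variable R : realType.

Definition density2 F : R :=
  (3 <= #|vset F|)%N%:R * ((#|eset F|%:R - 1) / (#|vset F|%:R - 2))
  + ((#|vset F| == 2%N) && (#|eset F| == 1%N))%:R * (1 / 2).

(* The subgraph without vertices has [density2] equal to [0], so the default
   value [0] does not change the maximum. *)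
Definition m2 H : R :=
  \big[Num.max/0]_(F : graph T | subgraph F H) density2 F.

Definition strictly_2balanced H : Prop :=
  forall F, proper_subgraph F H -> m2 F < m2 H.

End Density.

Definition induced_edges G (K : {set T}) : {set {set T}} :=
  [set e in eset G | e \subset K].

End Graphs.

Definition isomorphic (S T : finType) (H : graph S) (F : graph T) : Prop :=
  exists f : {x : S | x \in vset H} -> {y : T | y \in vset F},
    bijective f /\
    forall x y, ([set val x; val y] \in eset H)
                = ([set val (f x); val (f y)] \in eset F).

Definition is_copy (S T : finType) (H : graph S) (G F : graph T) : Prop :=
  subgraph F G /\ isomorphic H F.

Definition X_ (T : finType) (G : graph T) (K : {set T}) : nat :=
  #|induced_edges G K|.

Definition Y_ (S T : finType) (H : graph S) (G : graph T) (K : {set T}) : nat :=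
  #|[set e in induced_edges G K |
      `[< exists F : graph T, is_copy H G F /\ e \in eset F >]]|.

(* The probability that the binomial random graph on the vertex set ['I_n] has
   the property [A]; the possible edges are the 2-element subsets of ['I_n], and
   by independence a graph has the product of its edge weights as probability.
   It is meaningful for [0 <= p <= 1]. *)
Definition gnp_prob (R : realType) (n : nat) (p : R)
    (A : graph 'I_n -> Prop) : R :=
  \sum_(G : graph 'I_n | (vset G == [set: 'I_n]) && `[< A G >])
    \prod_(e : {set 'I_n} | #|e| == 2%N) (if e \in eset G then p else 1 - p).

(* Main.v *)
(** Let d = m_2(H).  If d <= 1 then n < k for large k, so let d > 1.  With
    x = k / log k we have n <= c x^d and p = C / x; a copy of H fixed on
    a subgraph J costs n^(v_H - v_J) p^(e_H - e_J), which is at most c C^(e_H) for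
    J = K_2 and, by strict 2-balancedness, polynomially small when J is a
    proper subgraph with at least two edges.

    For fixed K, let I be a maximal edge-disjoint family of copies of H having
    an edge in K.  The expected number of such copies is a small multiple of
    k log k, so |I| <= s := Theta(k log k) up to probability
    mu^s / s! = exp(-Omega(k log k)), which beats the union bound n^k over K.
    An edge of K that lies in a copy but not in the union of I forms with I a
    cluster: two copies sharing an edge, and each with its own edge in K.
    Clusters have polynomially small density (two copies sharing a single edge
    gain the factor k / n from the second edge in K), hence a maximal
    edge-disjoint family of clusters has only O(k) members.  All edges to be
    counted lie in the union of I or in a copy that meets a set of O(k) edges.
    Finally a sunflower argument shows that each edge is in only
    O(eta log k) copies, with eta as small as needed: a kernel of at least two
    edges has O(1) petals, a kernel of one edge at most eta log k petals.  The bound on X_K is Chernoff's. *)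
Require Import Defs.
From HB Require Import structures.
From mathcomp Require Import all_boot all_order all_algebra.
From mathcomp Require Import ring lra.
From mathcomp Require Import all_classical all_reals all_analysis.
From mathcomp Require Import fintype finset.
Set Implicit Arguments.
Unset Strict Implicit.
Unset Printing Implicit Defensive.
Import Order.TTheory GRing.Theory Num.Theory.
Import numFieldNormedType.Exports.
Local Open Scope ring_scope.

(** * Random subsets of a finite set *)

Section RandomSubset.
Variables (R : realFieldType) (U : finType) (q : U -> R).
Hypothesis q01 : forall u, 0 <= q u <= 1.
Implicit Types (E S F : {set U}) (Z FF : {set {set U}}).

(** Product measure on the subsets of [U]: each [u] is chosen with probability [q u], independently
    of the others. *)
Definition subset_weight E : R := \prod_u (if u \in E then q u else 1 - q u).

Definition Pr (A : pred {set U}) : R := \sum_(E | A E) subset_weight E.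

(** The probability that [S] lies in the random set, see [Pr_subset]. *)
Definition mono_weight S : R := \prod_(u in S) q u.

Lemma subset_weight_ge0 E : 0 <= subset_weight E.
Proof.
apply: prodr_ge0 => u _; case/andP: (q01 u) => q0 q1.
by case: ifP => _ //; rewrite subr_ge0.
Qed.

Lemma mono_weight_ge0 S : 0 <= mono_weight S.
Proof. by apply: prodr_ge0 => u _; case/andP: (q01 u). Qed.

Lemma mono_weight_le p S : (forall u, q u <= p) -> mono_weight S <= p ^+ #|S|.
Proof.
move=> qp; rewrite -prodr_const; apply: ler_prod => u _.
by rewrite qp andbT; case/andP: (q01 u).
Qed.

Lemma mono_weightU S F : mono_weight (S :|: F) = mono_weight S * mono_weight (F :\: S).
Proof.
rewrite /mono_weight (big_setID S) /=; congr (_ * _).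
  by apply: eq_bigl => u; rewrite !inE; case: (u \in S); rewrite ?andbT ?andbF.
by apply: eq_bigl => u; rewrite !inE; case: (u \in S); rewrite ?andbT ?andbF.
Qed.

Lemma Pr_setT : Pr predT = 1.
Proof.
transitivity (\prod_(u : U) (q u + (1 - q u))).
  by rewrite bigA_distr /=; apply: eq_bigl => E; rewrite inE.
by rewrite big1 // => u _; rewrite addrC subrK.
Qed.

Lemma Pr_le (A B : pred {set U}) : (forall E, A E -> B E) -> Pr A <= Pr B.
Proof.
move=> AB; rewrite /Pr [leRHS](bigID A) /= ler_wpDr //.
  by apply: sumr_ge0 => E _; apply: subset_weight_ge0.
rewrite [leLHS](eq_bigl (fun E => B E && A E)) // => E.
by case: (boolP (A E)) => [/AB ->|]; rewrite ?andbF.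
Qed.

Lemma Pr_bigcup (I : finType) (D : pred I) (A : I -> pred {set U}) :
  Pr [pred E : {set U} | [exists i, D i && A i E]] <= \sum_(i | D i) Pr (A i).
Proof.
rewrite /Pr /= (exchange_big_dep [pred E : {set U} | [exists i, D i && A i E]]) /=.
  apply: ler_sum => E /existsP[i /andP[Di Ai]].
  rewrite (bigD1 i) ?Di ?Ai //= ler_wpDr //.
  by apply: sumr_ge0 => j _; apply: subset_weight_ge0.
by move=> i E Di Ai; apply/existsP; exists i; rewrite Di Ai.
Qed.

Lemma Pr_orb (A B : pred {set U}) : Pr [pred E : {set U} | A E || B E] <= Pr A + Pr B.
Proof.
rewrite /Pr (bigID A) /=; apply: lerD.
  rewrite [leLHS](eq_bigl A) // => E.
  by case: (A E); rewrite ?andbF.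
rewrite [leRHS](bigID A) /= ler_wpDl //.
  by apply: sumr_ge0 => E _; apply: subset_weight_ge0.
rewrite [leLHS](eq_bigl (fun E => B E && ~~ A E)) // => E.
by case: (A E); rewrite ?andbF.
Qed.

(** Independence: expanding the right side by choosing one of the two summands for each [u] gives
    one term per set [E]. For constant [f] this is the generating function of [#|E :&: B|]. *)
Lemma sum_subset_weight (f : U -> R) B :
  \sum_E subset_weight E * \prod_(u in E :&: B) f u =
  \prod_(u in B) (q u * f u + (1 - q u)).
Proof.
transitivity (\prod_u ((if u \in B then q u * f u else q u) + (1 - q u))).
  rewrite bigA_distr [RHS](eq_bigl predT) => [|E]; last by rewrite inE.
  apply: eq_bigr => E _; rewrite /subset_weight [X in _ * X]big_mkcond.
  rewrite -big_split /=; apply: eq_bigr => u _; rewrite inE.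
  by case: (u \in E); case: (u \in B); rewrite ?mulr1.
rewrite [RHS]big_mkcond; apply: eq_bigr => u _.
by case: ifP => // _; rewrite addrC subrK.
Qed.

Lemma Pr_subset S : Pr [pred E : {set U} | S \subset E] = mono_weight S.
Proof.
(* The second summand is 0 on [S], which kills every term of the expansion whose set [E] does not
   contain [S]. *)
transitivity (\prod_u ((if u \in S then q u else q u) + (if u \in S then 0 else 1 - q u))).
  rewrite bigA_distr /Pr [RHS](eq_bigl predT) => [|E]; last by rewrite inE.
  rewrite [LHS]big_mkcond; apply: eq_bigr => E _ /=.
  case: ifP => [sSE|/negbT/subsetPn[u uS uE]].
    apply: eq_bigr => u _; case: ifP => uE; first by case: ifP.
    by case: ifP => // uS; rewrite (subsetP sSE) in uE.
  by rewrite (bigD1 u) //= (negPf uE) uS mul0r.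
rewrite /mono_weight [RHS]big_mkcond; apply: eq_bigr => u _.
by case: ifP => _; rewrite ?addr0 // addrC subrK.
Qed.

(** Exponential Markov inequality: since [z <= 1], the event implies [z ^+ t <= z ^+ #|E :&: B|],
    and the expectation of the right side factorises. *)
Lemma Pr_card_le (B : {set U}) (z : R) (t : nat) : 0 < z -> z <= 1 ->
  Pr [pred E : {set U} | #|E :&: B| <= t]%N <= \prod_(u in B) (1 - q u * (1 - z)) / z ^+ t.
Proof.
move=> z0 z1; rewrite ler_pdivlMr ?exprn_gt0 //.
have -> : \prod_(u in B) (1 - q u * (1 - z)) = \prod_(u in B) (q u * z + (1 - q u)).
  by apply: eq_bigr => u _; rewrite mulrBr mulr1 opprB addrCA.
rewrite -sum_subset_weight /Pr mulr_suml [leRHS](bigID [pred E : {set U} | #|E :&: B| <=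
  t]%N) /=.
rewrite ler_wpDr //.
  apply: sumr_ge0 => E _; rewrite mulr_ge0 ?subset_weight_ge0 //.
  by apply: prodr_ge0 => u _; apply: ltW.
apply: ler_sum => E Et; rewrite ler_wpM2l ?subset_weight_ge0 //.
by rewrite prodr_const ler_wiXn2l // ltW.
Qed.

Lemma sum_imset_le (I J : finType) (D : {pred I}) (h : I -> J) (w : J -> R) :
  (forall j, 0 <= w j) -> \sum_(j in [set h i | i in D]) w j <= \sum_(i in D) w (h i).
Proof.
move=> w0; rewrite (partition_big_imset h) /=; apply: ler_sum => j /imsetP[i iD ->].
rewrite (bigD1 i) ?iD ?eqxx //= ler_wpDr //.
by apply: sumr_ge0.
Qed.

(** Expanding the power yields the monomial of each [m]-set [m!] times, besides other nonnegative
    terms. *)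
Lemma esym_le (I : finType) (D : {set I}) (w : I -> R) m : (forall i, 0 <= w i) ->
  \sum_(Z : {set I} | (Z \subset D) && (#|Z| == m)) \prod_(i in Z) w i
    <= (\sum_(i in D) w i) ^+ m / m`!%:R.
Proof.
move=> w0; rewrite ler_pdivlMr ?ltr0n ?fact_gt0 // mulrC.
elim: m => [|m IHm].
  rewrite fact0 mul1r expr0 (big_pred1 set0) ?big_set0 // => Z /=.
  rewrite cards_eq0 andbC; case: eqP => // ->; exact: sub0set.
set e' := (X in _ * X); set e := (X in _ * X) in IHm.
(* Double counting of pairs of an [m.+1]-set and a member [i] of it: removing [i] leaves an [m]-set,
   and for fixed [i] this removal is injective. *)
suff key : m.+1%:R * e' <= (\sum_(i in D) w i) * e.
  rewrite factS natrM mulrAC exprS (le_trans (ler_wpM2r (ler0n _ _) key)) //.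
  by rewrite -mulrA [e * _]mulrC ler_wpM2l // sumr_ge0.
rewrite big_distrr /=.
under eq_bigr => Z /andP[_ /eqP Zm].
  have -> : m.+1%:R * \prod_(i in Z) w i = \sum_(i in Z) w i * \prod_(j in Z :\ i) w j.
    rewrite -Zm mulr_natl -sumr_const; apply: eq_bigr => i iZ.
    by rewrite (big_setD1 i).
  over.
rewrite /= (exchange_big_dep (mem D)) /=; last first.
  by move=> Z i /andP[/subsetP ZD _] /ZD.
rewrite mulr_suml; apply: ler_sum => i iD; rewrite -mulr_sumr ler_wpM2l //.
pose A := [set Z : {set I} | (Z \subset D) && (#|Z| == m.+1) && (i \in Z)].
have -> : \sum_(Z : {set I} | (Z \subset D) && (#|Z| == m.+1) && (i \in Z))
   \prod_(j in Z :\ i) w j = \sum_(Z in [set Z :\ i | Z : {set I} in A]) \prod_(j in Z) w j.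
  rewrite big_imset /=; first by apply: eq_bigl => Z; rewrite inE.
  move=> Z1 Z2; rewrite !inE => /andP[_ i1] /andP[_ i2] e12.
  by rewrite -(setD1K i1) -(setD1K i2) e12.
rewrite [leRHS](bigID (mem [set Z :\ i | Z : {set I} in A])) /= ler_wpDr //.
  by apply: sumr_ge0 => Z _; apply: prodr_ge0.
rewrite [leLHS](eq_bigl (fun Z : {set I} => (Z \subset D) && (#|Z| == m) && (Z \in [set Z
  :\ i | Z : {set I} in A]))) //.
move=> Z /=; case ZA: (Z \in _); rewrite ?andbF // andbT; apply/esym.
case/imsetP: ZA => Y; rewrite inE => /andP[/andP[YD /eqP Ym] iY] ->.
rewrite (subset_trans (subsetDl _ _) YD) /=.
by move: (cardsD1 i Y); rewrite iY Ym add1n => -[<-]; rewrite eqxx.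
Qed.

Definition has_disjoint FF m E : bool :=
  [exists Z : {set {set U}},
    [&& Z \subset FF, trivIset Z, #|Z| == m & cover Z \subset E]].

(** Union bound over the disjoint families: the weight of the cover is the product of the weights of
    the members, so an elementary symmetric sum bounds the total. *)
Lemma Pr_has_disjoint FF m :
  Pr (has_disjoint FF m) <= (\sum_(F in FF) mono_weight F) ^+ m / m`!%:R.
Proof.
apply: le_trans (esym_le FF m mono_weight_ge0).
apply: le_trans (_ : Pr [pred E : {set U} | [exists Z : {set {set U}},
   [&& Z \subset FF, trivIset Z & #|Z| == m] && (cover Z \subset E)]] <= _).
  apply: Pr_le => E /existsP[Z /and4P[? ? ? ?]]; apply/existsP; exists Z.
  by apply/andP; split=> //; apply/and3P.
apply: le_trans (Pr_bigcup _ _) _.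
rewrite [leRHS](bigID trivIset) /= ler_wpDr //.
  by apply: sumr_ge0 => Z _; apply: prodr_ge0 => F _; apply: mono_weight_ge0.
rewrite [leLHS](eq_bigl (fun Z => (Z \subset FF) && (#|Z| == m) && trivIset Z)); last first.
  by move=> Z; rewrite -andbA [X in _ && X]andbC.
apply: ler_sum => Z /andP[_ tZ].
by rewrite Pr_subset /mono_weight big_trivIset.
Qed.

End RandomSubset.

(** * Maximal disjoint families and sunflowers *)

Section DisjointFamilies.
Variable U : finType.
Implicit Types (E S F B : {set U}) (Z FF HH : {set {set U}}).
Local Open Scope nat_scope.

(** A disjoint family with at least [m] members contains one with exactly [m]. *)
Lemma has_disjointPn FF m E Z : ~~ has_disjoint FF m E ->
  Z \subset FF -> trivIset Z -> cover Z \subset E -> #|Z| < m.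
Proof.
move=> nE ZF tZ cZ; rewrite ltnNge; apply: contra nE => mZ.
have /card_geqP[s [us sm sZ]] := mZ.
apply/existsP; exists [set x in s].
have sub : [set x in s] \subset Z by apply/subsetP => x; rewrite inE => /sZ.
rewrite (subset_trans sub ZF) (trivIsetS sub tZ) /=.
rewrite cardsE (card_uniqP us) sm eqxx /=.
apply: subset_trans cZ; apply/bigcupsP => A As.
by apply: (bigcup_max A) => //; apply: (subsetP sub).
Qed.

(** A disjoint family of maximum size works: a nonempty [F] disjoint from its cover is not a member
    and could be added. *)
Lemma exists_maximal_disjoint FF E :
  exists Z, [/\ Z \subset FF, trivIset Z, cover Z \subset E &
    forall F, F \in FF -> F \subset E -> F != set0 -> ~~ [disjoint F & cover Z]].
Proof.
pose P Z := [&& Z \subset FF, trivIset Z & cover Z \subset E].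
have P0 : P set0.
  by rewrite /P sub0set /cover big_set0 sub0set andbT /trivIset /cover !big_set0 cards0.
case: (arg_maxnP (fun Z => #|Z|) P0) => Z /and3P[ZF tZ cZ] Zmax.
exists Z; split=> // F FF' FE F0; apply/negP => dF.
have FZ : F \notin Z.
  apply: contra F0 => FZ; rewrite -subset0 -(setIid F) subset0 setI_eq0.
  apply: disjointWr dF; exact: (bigcup_max F).
suff /Zmax : P (F |: Z) by move=> le; have : #|F |: Z| <= #|Z| := le; rewrite cardsU1 FZ
  add1n ltnn.
apply/and3P; split.
- by rewrite subUset sub1set FF' ZF.
- apply/trivIsetP => A C; rewrite !inE => /orP[/eqP->|AZ] /orP[/eqP->|CZ] nAC.
  + by rewrite eqxx in nAC.
  + by apply: disjointWr dF; apply: (bigcup_max C).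
  + by rewrite disjoint_sym; apply: disjointWr dF; apply: (bigcup_max A).
  + by move/trivIsetP: tZ; apply.
- by rewrite /cover big_setU1 // subUset FE cZ.
Qed.

Lemma card_cover_le Z b : {in Z, forall F, #|F| <= b} -> #|cover Z| <= #|Z| * b.
Proof.
move=> Zb; apply: leq_trans (leq_card_cover _) _.
by rewrite -sum_nat_const; apply: leq_sum => F /Zb.
Qed.

(** * Sunflowers and codegrees *)

(** The link of [S] in the hypergraph [HH]; disjoint members of it are the petals of a sunflower
    with kernel [S]. *)
Definition link HH S := [set F :\: S | F in HH & S \proper F].

Definition codegree HH E S := #|[set F in HH | (S \subset F) && (F \subset E)]|.

Section Uniform.
Variables (HH : {set {set U}}) (e : nat) (E : {set U}).
Hypothesis HHe : {in HH, forall F, #|F| = e}.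

(** A maximal disjoint family in the link has fewer than [L] petals, so it covers at most [L * e]
    elements. Each counted [F] properly contains [S] and so meets that cover in some [u] outside
    [S]; it is then counted in the codegree of [u |: S]. *)
Lemma codegree_sunflower S L b : #|S| < e ->
  ~~ has_disjoint (link HH S) L E ->
  (forall u, u \notin S -> codegree HH E (u |: S) <= b) ->
  codegree HH E S <= L * e * b.
Proof.
move=> Se nL ub.
have [Z [ZF tZ cZ Zmax]] := exists_maximal_disjoint (link HH S) E.
have ZL := has_disjointPn nL ZF tZ cZ.
have linkS A : A \in link HH S -> #|A| <= e /\ [disjoint A & S].
  case/imsetP => F; rewrite inE => /andP[FH SF] ->; split.
    by rewrite -(HHe FH) subset_leq_card // subsetDl.
  by rewrite -setI_eq0 setDE -setIA (setIC (~: S)) setICr setI0.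
have cZe : #|cover Z| <= L * e.
  apply: leq_trans (_ : #|Z| * e <= _); last by rewrite leq_mul2r ltnW ?orbT.
  by apply: card_cover_le => A /(subsetP ZF)/linkS[].
have sub : [set F in HH | (S \subset F) && (F \subset E)] \subset
    \bigcup_(u in cover Z) [set F in HH | (u |: S \subset F) && (F \subset E)].
  apply/subsetP => F; rewrite inE => /and3P[FH SF FE].
  have pF : S \proper F by rewrite properEcard SF (HHe FH) Se.
  have : ~~ [disjoint F :\: S & cover Z].
    apply: Zmax; first by apply/imsetP; exists F; rewrite ?inE ?FH.
      by apply: subset_trans (subsetDl _ _) FE.
    by rewrite setD_eq0; case/andP: pF.
  rewrite -setI_eq0 => /set0Pn[u]; rewrite !inE => /andP[/andP[uS uF] uZ].
  by apply/bigcupP; exists u => //; rewrite inE FH FE subUset sub1set uF SF.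
apply: leq_trans (subset_leq_card sub) _.
apply: leq_trans (_ : \sum_(u in cover Z) b <= _); last first.
  by rewrite sum_nat_const leq_mul2r cZe orbT.
elim/big_ind2 : _ => [|A m B n Am Bn|u /bigcupP[A AZ uA]]; first by rewrite cards0.
  by apply: leq_trans (leq_card_setU _ _) (leq_add Am Bn).
apply: ub; have [_ dA] := linkS _ (subsetP ZF _ AZ).
by move: dA; rewrite disjoint_subset => /subsetP/(_ _ uA).
Qed.

(** Enlarging the kernel by one element costs a factor [L * e]; a kernel with [e] elements lies in
    at most one member, itself. *)
Lemma codegree_le L S : 0 < L -> 0 < e -> 2 <= #|S| ->
  (forall S', 2 <= #|S'| -> ~~ has_disjoint (link HH S') L E) ->
  codegree HH E S <= (L * e) ^ (e - #|S|).
Proof.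
move=> L0 e0 S2 nL; move: {2}(e - #|S|) (leqnn (e - #|S|)) => j.
elim: j S S2 => [|j IHj] S S2 Sj.
  have eS : e <= #|S| by rewrite -subn_eq0 -leqn0.
  have -> : e - #|S| = 0 by apply/eqP; rewrite subn_eq0.
  rewrite expn0 -(cards1 S) subset_leq_card //.
  apply/subsetP => F; rewrite !inE => /and3P[FH SF _].
  by rewrite eq_sym eqEcard SF (HHe FH).
have [eS|Se] := leqP e #|S|.
  by apply: IHj => //; move: eS; rewrite -subn_eq0 => /eqP->.
have -> : e - #|S| = (e - #|S|.+1).+1 by rewrite subnSK.
rewrite expnS; apply: codegree_sunflower (nL _ S2) _ => // u uS.
have := IHj (u |: S); rewrite cardsU1 uS add1n; apply; first exact: leqW.
by rewrite -ltnS subnSK.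
Qed.

(** The first enlargement uses the weaker bound [r] on the petals, all later ones use [L]. *)
Lemma codegree1_le L r u : 0 < L -> 1 < e ->
  (forall S, 2 <= #|S| -> ~~ has_disjoint (link HH S) L E) ->
  ~~ has_disjoint (link HH [set u]) r E ->
  codegree HH E [set u] <= r * e * (L * e) ^ e.
Proof.
move=> L0 e1 nL nr; apply: codegree_sunflower nr _; first by rewrite cards1.
move=> v; rewrite inE => vu.
have c2 : #|v |: [set u]| = 2 by rewrite cards2 vu.
apply: leq_trans (codegree_le L0 (ltnW e1) _ nL) _; first by rewrite c2.
by rewrite leq_pexp2l ?leq_subr // muln_gt0 L0 ltnW.
Qed.

(** * Clusters and the number of covered elements *)

Definition touches B F := ~~ [disjoint F & B].

(** Asking for [P.2 :\: P.1] to meet [B], and not just [P.2], forces the second member to bring a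
    new element of [B]; this excludes equal members and is the source of the gain when they share a
    single element. *)
Definition clusters B : {set {set U}} :=
  [set P.1 :|: P.2 | P : {set U} * {set U} in
    [set P | [&& P.1 \in HH, P.2 \in HH, touches B P.1, touches P.1 P.2 &
              touches B (P.2 :\: P.1)]]].

Lemma touchesP B F : reflect (exists2 u, u \in F & u \in B) (touches B F).
Proof.
rewrite /touches -setI_eq0; apply: (iffP (set0Pn _)) => [[u]|[u uF uB]].
  by rewrite inE => /andP[? ?]; exists u.
by exists u; rewrite inE uF.
Qed.

(** Let [I] and [J] be maximal disjoint families of members meeting [B] and of clusters. A covered
    element outside [cover I] lies in some [F] that forms a cluster with a member of [I]; as this
    cluster meets [cover J], the set [F] meets the small set [D], and the codegree bound limits all
    such [F]. *)
Lemma card_covered_le B s m Delta :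
  ~~ has_disjoint [set F in HH | touches B F] s E ->
  ~~ has_disjoint (clusters B) m E ->
  (forall u, codegree HH E [set u] <= Delta) ->
  #|[set u in B | [exists F in HH, (F \subset E) && (u \in F)]]|
    <= s * e + (m * (2 * e) + m * (2 * e) * e) * (Delta * e).
Proof.
move=> ns nm hD.
have [I [IF tI cI Imax]] := exists_maximal_disjoint [set F in HH | touches B F] E.
have [J [JF tJ cJ Jmax]] := exists_maximal_disjoint (clusters B) E.
have Is := has_disjointPn ns IF tI cI; have Jm := has_disjointPn nm JF tJ cJ.
have IH F : F \in I -> F \in HH by move/(subsetP IF); rewrite inE => /andP[].
have JE : {in J, forall F, #|F| <= 2 * e}.
  move=> F /(subsetP JF)/imsetP[[F1 F2]]; rewrite inE /= => /and5P[h1 h2 _ _ _] ->.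
  apply: leq_trans (leq_card_setU _ _) _.
  by rewrite (HHe h1) (HHe h2) addnn mul2n.
have cJm : #|cover J| <= m * (2 * e).
  apply: leq_trans (card_cover_le JE) _.
  by rewrite leq_mul2r ltnW // orbT.
pose I' := [set F in I | touches (cover J) F].
have cI'm : #|cover I'| <= m * (2 * e) * e.
  apply: leq_trans (_ : #|I'| * e <= _).
    by apply: card_cover_le => F; rewrite inE => /andP[/IH/HHe -> _].
  rewrite leq_mul2r; apply/orP; right; apply: leq_trans cJm.
  (* Choosing an element of [cover J] in each member of [I'] is injective because members of [I] are
     disjoint; so [I'] is no larger than [cover J]. *)
  pose h F := [pick x | (x \in F) && (x \in cover J)].
  have hP F : F \in I' -> exists x, [/\ h F = Some x, x \in F & x \in cover J].
    rewrite inE /h => /andP[_ /touchesP [x xF xJ]]; case: pickP => [y /andP[? ?]|/(_ x)].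
      by exists y.
    by rewrite xF xJ.
  have hinj : {in I' &, injective h}.
    move=> F G FI GI hFG; have [x [hx xF _]] := hP _ FI.
    have [y [hy yG _]] := hP _ GI.
    have xy : x = y by move: hFG; rewrite hx hy => -[].
    rewrite -{}xy in yG; apply/eqP; apply: contraT => nFG.
    have FI0 : F \in I by move: FI; rewrite inE => /andP[].
    have GI0 : G \in I by move: GI; rewrite inE => /andP[].
    have /trivIsetP/(_ _ _ FI0 GI0 nFG) := tI.
    by rewrite disjoint_subset => /subsetP/(_ _ xF); rewrite inE yG.
  rewrite -(card_in_imset hinj).
  rewrite -(card_imset (mem (cover J)) (@Some_inj _)); apply: subset_leq_card.
  apply/subsetP => y /imsetP[F /hP[x [-> _ xJ]] ->]; exact: imset_f.
pose D := cover J :|: cover I'.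
have cD : #|D| <= m * (2 * e) + m * (2 * e) * e.
  by apply: leq_trans (leq_card_setU _ _) _; apply: leq_add.
(* [N] collects all elements of members inside [E] that meet [D]. *)
pose N := \bigcup_(u in D) cover [set F in HH | ([set u] \subset F) && (F \subset E)].
have cN : #|N| <= #|D| * (Delta * e).
  rewrite -sum_nat_const /N; elim/big_ind2 : _ => [|A a C c Aa Cc|u _]; first by rewrite
    cards0.
    by apply: leq_trans (leq_card_setU _ _) _; apply: leq_add.
  apply: leq_trans (card_cover_le (b := e) _) _.
    by move=> F; rewrite inE => /andP[/HHe ->].
  by rewrite leq_mul2r [X in _ || X]hD orbT.
have cIs : #|cover I| <= s * e.
  apply: leq_trans (card_cover_le (b := e) _) _; first by move=> F /IH/HHe ->.
  by rewrite leq_mul2r ltnW // orbT.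
apply: leq_trans (_ : #|cover I :|: N| <= _); last first.
  apply: leq_trans (leq_card_setU _ _) _; apply: leq_add => //.
  by apply: leq_trans cN _; rewrite leq_mul2r cD orbT.
apply: subset_leq_card; apply/subsetP => u; rewrite !inE => /andP[uB].
case/existsP => F /and3P[FH FE uF].
case uI: (u \in cover I) => //=.
suff /touchesP[x xF xD] : touches D F.
  apply/bigcupP; exists x => //; apply/bigcupP; exists F => //.
  by rewrite inE FH FE sub1set xF.
have FB : touches B F by apply/touchesP; exists u.
have /touchesP[g gF /bigcupP[F' F'I gF']] : touches (cover I) F.
  by apply: Imax => //; [rewrite inE FH|apply/set0Pn; exists u].
have F'E : F' \subset E by apply: subset_trans cI; apply: (bigcup_max F').
have uF' : u \notin F'.
  by apply/negP => uF'; move/negP: uI; apply; apply/bigcupP; exists F'.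
(* Maximality of [J] gives [x] in [cover J]. Either [x] is in [F], or [x] is in [F']; then [F']
   belongs to [I'] and the shared element [g] puts [F] in contact with [cover I']. *)
have /touchesP[x] : touches (cover J) (F' :|: F).
  apply: Jmax; last 2 first.
  - by rewrite subUset F'E FE.
  - by apply/set0Pn; exists u; rewrite inE uF orbT.
  apply/imsetP; exists (F', F) => //; rewrite inE /= (IH _ F'I) FH /=.
  move: (subsetP IF _ F'I); rewrite inE => /andP[_ ->] /=.
  apply/andP; split; apply/touchesP; first by exists g.
  by exists u => //; rewrite inE uF' uF.
rewrite inE => /orP[xF'|xF] xJ; last first.
  by apply/touchesP; exists x => //; rewrite inE xJ.
apply/touchesP; exists g => //; rewrite inE; apply/orP; right.
by apply/bigcupP; exists F' => //; rewrite inE F'I /=; apply/touchesP; exists x.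
Qed.

End Uniform.
End DisjointFamilies.

(** * Random subsets and uniform hypergraphs *)

Section RandomUniform.
Variables (R : realFieldType) (U : finType) (q : U -> R).
Hypothesis q01 : forall u, 0 <= q u <= 1.
Variables (HH : {set {set U}}) (e : nat).
Hypothesis HHe : {in HH, forall F : {set U}, #|F| = e}.
Implicit Types (E S F B : {set U}).
Local Notation w := (mono_weight q).
Local Notation Pr := (Pr q).
Let w_ge0 := mono_weight_ge0 q01.

Lemma sum_link S : \sum_(F in link HH S) w F <= \sum_(F in HH | S \proper F) w (F :\: S).
Proof.
apply: le_trans (sum_imset_le _ _ w_ge0) _.
by rewrite (eq_bigl (fun F => (F \in HH) && (S \proper F))) // => F; rewrite inE.
Qed.

(** For fixed first member, the second ones are sorted by the intersection [S], with at most [2 ^ e]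
    choices. Two or more common elements give [nu] directly; a single one does so thanks to the
    further element in [B]. *)
Lemma sum_clusters B (mu nu : R) : 0 <= nu ->
  (forall S, (2 <= #|S|)%N -> \sum_(F in HH | S \proper F) w (F :\: S) <= nu) ->
  (forall u, \sum_(F in HH | (u \in F) && touches B (F :\ u)) w (F :\ u) <= nu) ->
  \sum_(F in HH | touches B F) w F <= mu ->
  \sum_(C in clusters HH B) w C <= mu * (2 ^+ e * nu).
Proof.
move=> nu0 nu2 nu1 hmu; apply: le_trans (sum_imset_le _ _ w_ge0) _.
rewrite (eq_bigl (fun P : {set U} * {set U} => ((P.1 \in HH) && touches B P.1) &&
   ((P.2 \in HH) && touches P.1 P.2 && touches B (P.2 :\: P.1)))); last first.
  by move=> P; rewrite inE; case: (P.1 \in HH); case: (P.2 \in HH); case: (touches B P.1).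
rewrite -(pair_big_dep (fun F => (F \in HH) && touches B F)
  (fun F1 F2 => (F2 \in HH) && touches F1 F2 && touches B (F2 :\: F1))
  (fun F1 F2 => w (F1 :|: F2))) /=.
apply: le_trans (_ : \sum_(F in HH | touches B F) w F * (2 ^+ e * nu) <= _); last first.
  by rewrite -mulr_suml ler_wpM2r // mulr_ge0 // exprn_ge0.
apply: ler_sum => F1 /andP[F1H F1B].
under eq_bigr do rewrite mono_weightU.
rewrite -mulr_sumr ler_wpM2l //.
rewrite (partition_big (fun F2 => F1 :&: F2) (fun S => (S \subset F1) && (S != set0)))
  /=; last first.
  move=> F2 /andP[/andP[_ F12] _]; rewrite subsetIl /=.
  by move: F12; rewrite /touches -setI_eq0 setIC.
apply: le_trans (_ : \sum_(S : {set U} | (S \subset F1) && (S != set0)) nu <= _).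
  apply: ler_sum => S /andP[SF1 S0].
  have [S2|S1] := leqP 2 #|S|.
    apply: le_trans (nu2 S S2); rewrite [leRHS](bigID (fun F2 => touches F1 F2 && touches
      B (F2 :\: F1) && (F1 :&: F2 == S))) /=.
    rewrite ler_wpDr ?sumr_ge0 //.
    rewrite [leLHS](eq_bigl (fun F2 => (F2 \in HH) && (S \proper F2) && (touches F1 F2 &&
      touches B (F2 :\: F1) && (F1 :&: F2 == S)))).
      apply: ler_sum => F2 /andP[_ /andP[_ /eqP <-]].
      by rewrite setDIr setDv setU0.
    move=> F2; case: (boolP (_ == _)) => [/eqP <-|_]; rewrite ?andbF //= ?andbT.
    case: (F2 \in HH) => //=; case: (touches F1 F2) => //=; last by rewrite andbF.
    case mB: (touches B _); last by rewrite andbF.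
    case/touchesP: mB => x; rewrite inE => /andP[x1 x2] _.
    by rewrite andbT; apply/esym/properP; split; [exact: subsetIr|exists x => //; rewrite
      inE (negPf x1)].
  have /eqP/cards1P[g Sg] : #|S| = 1%N.
    by apply/eqP; rewrite eqn_leq -ltnS S1 card_gt0.
  apply: le_trans (nu1 g); rewrite [leRHS](bigID (fun F2 => touches F1 F2 && touches B
    (F2 :\: F1) && (F1 :&: F2 == S))) /=.
  rewrite ler_wpDr ?sumr_ge0 //.
  rewrite [leLHS](eq_bigl (fun F2 => (F2 \in HH) && ((g \in F2) && touches B (F2 :\ g))
    && (touches F1 F2 && touches B (F2 :\: F1) && (F1 :&: F2 == S)))).
    apply: ler_sum => F2 /andP[_ /andP[_ /eqP]]; rewrite Sg => <-.
    by rewrite setDIr setDv setU0.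
  move=> F2; case: (boolP (_ == _)) => [/eqP|_]; rewrite ?andbF //= ?andbT.
  rewrite Sg => F12.
  case: (F2 \in HH) => //=; case: (touches F1 F2) => //=; last by rewrite andbF.
  rewrite -F12 setDIr setDv setU0; case: (touches B _); rewrite ?andbF // !andbT.
  by apply/esym; have := set11 g; rewrite -F12 inE => /andP[].
rewrite sumr_const -[leLHS]mulr_natl ler_wpM2r //.
rewrite -natrX ler_nat -(HHe F1H) -card_powerset subset_leq_card //.
by apply/subsetP => S; rewrite !inE => /andP[].
Qed.

Definition covered B E := [set u in B :&: E | [exists F in HH, (F \subset E) && (u \in F)]].

(* [s] and [m] bound disjoint families of copies and of clusters, [L] and [r] the
   number of petals of sunflowers whose kernel has at least two edges, resp. one. *)
Lemma Pr_covered (BB : {set {set U}}) (mu nu A p z : R) (N s m L r t b : nat) :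
  (0 < L)%N -> (1 < e)%N -> 0 < z -> z <= 1 -> 0 <= nu ->
  (forall B, B \in BB -> #|B| = N /\ {in B, forall u, q u = p}) ->
  (forall S, (2 <= #|S|)%N -> \sum_(F in HH | S \proper F) w (F :\: S) <= nu) ->
  (forall u, \sum_(F in HH | u \in F) w (F :\ u) <= A) ->
  (forall B u, B \in BB ->
     \sum_(F in HH | (u \in F) && touches B (F :\ u)) w (F :\ u) <= nu) ->
  (forall B, B \in BB -> \sum_(F in HH | touches B F) w F <= mu) ->
  (s * e + (m * (2 * e) + m * (2 * e) * e) * (r * e * (L * e) ^ e * e) <= b)%N ->
  Pr [pred E : {set U} | [exists B in BB, (b < #|covered B E|)%N || (#|E :&: B| <= t)%N]] <=
    #|BB|%:R * (mu ^+ s / s`!%:R + (mu * (2 ^+ e * nu)) ^+ m / m`!%:R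
                + (1 - p * (1 - z)) ^+ N / z ^+ t)
    + (#|HH| * 2 ^ e)%:R * nu ^+ L + #|cover HH|%:R * (A ^+ r / r`!%:R).
Proof.
move=> L0 e1 z0 z1 nu0 BBN nu2 hA nu1 hmu hb.
(* Only kernels contained in some member need a union bound: any other kernel has an empty link. *)
pose SS := \bigcup_(F in HH) powerset F.
pose badB B E := has_disjoint [set F in HH | touches B F] s E || has_disjoint (clusters
  HH B) m E
                 || (#|E :&: B| <= t)%N.
pose bad1 E := [exists B, (B \in BB) && badB B E].
pose bad2 E := [exists S : {set U}, (S \in SS) && (2 <= #|S|)%N && has_disjoint (link HH
  S) L E].
pose bad3 E := [exists u, (u \in cover HH) && has_disjoint (link HH [set u]) r E].
(* Outside the three bad events the deterministic bound [card_covered_le] applies to every [B]. *)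
apply: le_trans (_ : Pr [pred E | (bad1 E || bad2 E) || bad3 E] <= _).
  apply: Pr_le => // E /existsP[B /andP[BB' hB]] /=; apply: contraT.
  rewrite !negb_or => /andP[/andP[g1 g2] g3].
  have : ~~ badB B E.
    by apply: contra g1 => g1; apply/existsP; exists B; rewrite BB'.
  rewrite !negb_or => /andP[/andP[ns nm] nt].
  rewrite (negPf nt) orbF in hB; move: hB; rewrite ltnNge => /negP[].
  have nL S : (2 <= #|S|)%N -> ~~ has_disjoint (link HH S) L E.
    move=> S2; have [SSS|SSS] := boolP (S \in SS).
      by apply: contra g2 => g2; apply/existsP; exists S; rewrite SSS S2.
    apply/negP => /existsP[Z /and4P[ZS _ /eqP ZL _]].
    have : (0 < #|Z|)%N by rewrite ZL.
    rewrite card_gt0 => /set0Pn[F /(subsetP ZS)/imsetP[F']].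
    rewrite inE => /andP[F'H /proper_sub SF'] _; move/negP: SSS; apply.
    by apply/bigcupP; exists F' => //; rewrite powersetE.
  have cod u : (codegree HH E [set u] <= r * e * (L * e) ^ e)%N.
    have [uH|uH] := boolP (u \in cover HH).
      apply: codegree1_le => //.
      by apply: contra g3 => g3; apply/existsP; exists u; rewrite uH.
    rewrite /codegree; set X := [set F in HH | _]; suff -> : X = set0 by rewrite cards0.
    apply/setP => F; rewrite !inE sub1set; apply/negP => /and3P[FH uF _].
    by move/negP: uH; apply; apply/bigcupP; exists F.
  apply: leq_trans hb; apply: leq_trans (card_covered_le HHe ns nm cod); apply:
    subset_leq_card.
  by apply/subsetP => u; rewrite !inE => /andP[/andP[-> _] ->].
apply: le_trans (Pr_orb q01 _ _) _; apply: lerD; first apply: le_trans (Pr_orb q01 _ _)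
  _; first apply: lerD.
- apply: le_trans (Pr_bigcup q01 _ _) _.
  rewrite mulr_natl -sumr_const; apply: ler_sum => B BB'.
  apply: le_trans (Pr_orb q01 _ _) _; apply: lerD; last first.
    apply: le_trans (Pr_card_le q01 _ _ z0 z1) _.
    have [<- Bp] := BBN B BB'.
    by rewrite -prodr_const (eq_bigr (fun=> 1 - p * (1 - z))) // => u /Bp ->.
  apply: le_trans (Pr_orb q01 _ _) _; apply: lerD; apply: le_trans (Pr_has_disjoint q01 _
    _) _;
    rewrite ler_wpM2r ?invr_ge0 // lerXn2r ?nnegrE ?sumr_ge0 //.
  + apply: le_trans (hmu _ BB'); apply: sumr_ge0 => //.
  + by rewrite (eq_bigl (fun F => (F \in HH) && touches B F)) ?hmu // => F; rewrite inE.
  + rewrite !mulr_ge0 ?exprn_ge0 //; apply: le_trans (hmu _ BB'); exact: sumr_ge0.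
  + by apply: sum_clusters => // [u|]; [apply: nu1|apply: hmu].
- apply: le_trans (Pr_bigcup q01 _ _) _.
  apply: le_trans (_ : \sum_(S in SS) nu ^+ L <= _).
    rewrite [leRHS](bigID (fun S : {set U} => (2 <= #|S|)%N)) /= ler_wpDr ?sumr_ge0 //.
      by move=> S _; rewrite exprn_ge0.
    apply: ler_sum => S /andP[_ S2]; apply: le_trans (Pr_has_disjoint q01 _ _) _.
    rewrite ler_pdivrMr ?ltr0n ?fact_gt0 //.
    apply: le_trans (_ : nu ^+ L * 1 <= _); last first.
      by rewrite ler_wpM2l ?exprn_ge0 // ler1n fact_gt0.
    rewrite mulr1 lerXn2r ?nnegrE ?sumr_ge0 //.
    exact: le_trans (sum_link S) (nu2 S S2).
  rewrite sumr_const -[leLHS]mulr_natl ler_wpM2r ?exprn_ge0 // ler_nat.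
  rewrite -sum_nat_const /SS; elim/big_ind2 : _ => [|a1 a2 c1 c2 h1 h2|F FH]; first by
    rewrite cards0.
    by apply: leq_trans (leq_card_setU _ _) (leq_add h1 h2).
  by rewrite card_powerset (HHe FH).
- apply: le_trans (Pr_bigcup q01 _ _) _.
  rewrite mulr_natl -sumr_const; apply: ler_sum => u _.
  apply: le_trans (Pr_has_disjoint q01 _ _) _.
  rewrite ler_wpM2r ?invr_ge0 //.
  have le : \sum_(F in link HH [set u]) w F <= A.
    apply: le_trans (sum_link _) _; apply: le_trans (hA u).
    rewrite [leRHS](bigID (fun F : {set U} => [set u] \proper F)) /= ler_wpDr ?sumr_ge0 //.
    rewrite le_eqVlt; apply/orP; left; apply/eqP/eq_bigl => F.
    case: (boolP (_ \proper F)) => [/proper_sub|]; rewrite ?andbF // sub1set => ->.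
    by rewrite !andbT.
  by rewrite lerXn2r ?nnegrE ?sumr_ge0 // (le_trans _ le) // sumr_ge0.
Qed.

End RandomUniform.

(** * Counting copies of a graph *)

Lemma card_maps_le (V I : finType) (W : {set V}) (D : V -> {set I}) :
  (#|[set phi : {ffun V -> I} | [forall x in W, phi x \in D x]]|
    <= (\prod_(x in W) #|D x|) * #|I| ^ (#|V| - #|W|))%N.
Proof.
pose F x : {set I} := if x \in W then D x else setT.
have sub : [set phi : {ffun V -> I} | [forall x in W, phi x \in D x]] \subset
    [set phi in family F].
  apply/subsetP => phi; rewrite !inE => /forallP h.
  apply/familyP => x; rewrite /F; case xW: (x \in W); last by rewrite in_setT.
  by have := h x; rewrite xW.
apply: leq_trans (subset_leq_card sub) _; rewrite cardsE card_family.
have -> : foldr muln 1%N [seq #|F x| | x : V] = (\prod_x #|F x|)%N.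
  by rewrite foldrE big_map big_enum.
rewrite (bigID (mem W)) /= leq_mul //.
  by rewrite [leqLHS](eq_bigr (fun x => #|D x|)) // => x xW; rewrite /F xW.
rewrite (eq_bigr (fun=> #|I|)); last first.
  by move=> x xW; rewrite /F (negPf xW) cardsT.
rewrite prod_nat_const (eq_card (B := ~: W)) => [|x]; last by rewrite !inE.
by rewrite cardsCs setCK.
Qed.

Section Copies.
Variables (V : finType) (E0 : {set {set V}}).
Hypothesis E02 : {in E0, forall a : {set V}, #|a| = 2%N}.
Variable I : finType.
Implicit Types (phi : {ffun V -> I}) (F S : {set {set I}}).

(** A copy is encoded by its edge set alone, so maps with the same image edges give the same member
    of the hypergraph [copies]. *)
Definition copy phi : {set {set I}} := [set phi @: (a : {set V}) | a in E0].

Definition copies : {set {set {set I}}} :=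
  [set copy phi | phi in [set phi : {ffun V -> I} | injectiveb phi]].

Definition inner_edges (K : {set I}) : {set {set I}} :=
  [set u : {set I} | (#|u| == 2%N) && (u \subset K)].

Lemma imset_ffun_inj phi : injective phi -> injective (fun a : {set V} => phi @: a).
Proof. exact: imset_inj. Qed.

Lemma card_copies : {in copies, forall F, #|F| = #|E0|}.
Proof.
move=> F /imsetP[phi]; rewrite inE => /injectiveP phi_inj ->.
by rewrite card_imset //; apply: imset_ffun_inj.
Qed.

Lemma copies_edge F u : F \in copies -> u \in F -> #|u| = 2%N.
Proof.
case/imsetP => phi; rewrite inE => /injectiveP phi_inj -> /imsetP[a aE ->].
by rewrite card_imset // E02.
Qed.

Lemma leq_card_copies : (#|copies| <= #|I| ^ #|V|)%N.
Proof.
apply: leq_trans (leq_imset_card _ _) _; rewrite -card_ffun.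
exact: max_card.
Qed.

Lemma bin_leq_exp n k : ('C(n, k) <= n ^ k)%N.
Proof.
apply: leq_trans (_ : n ^_ k <= _)%N.
  by rewrite -bin_ffact leq_pmulr // fact_gt0.
by elim: k n => [|k IHk] n //; rewrite ffactnSr expnSr leq_mul // leq_subr.
Qed.

Lemma leq_card_cover_copies : (#|cover copies| <= #|I| ^ 2)%N.
Proof.
apply: leq_trans (bin_leq_exp _ _); rewrite -card_draws.
apply: subset_leq_card; apply/subsetP => u /bigcupP[F Fc uF].
by rewrite inE (copies_edge Fc uF).
Qed.

Variables (R : realFieldType) (p : R).
Hypotheses (p0 : 0 <= p) (p1 : p <= 1).
(* Subsets other than pairs get probability [0], so a random graph is a random
   subset of the type [{set I}]. *)
Definition edge_prob (u : {set I}) : R := if #|u| == 2%N then p else 0.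
Local Notation w := (mono_weight edge_prob).

Lemma edge_prob01 u : 0 <= edge_prob u <= 1.
Proof. by rewrite /edge_prob; case: ifP => _; rewrite ?p0 ?p1 // lexx ler01. Qed.

Lemma edge_prob_le u : edge_prob u <= p.
Proof. by rewrite /edge_prob; case: ifP. Qed.

(** First moment bound: each copy costs [p] for every edge outside [S], and the classes [M j], which
    prescribe where some vertices go, bound the number of copies. *)
Lemma sum_copies_le (P : pred {set {set I}}) (S : {set {set I}}) (J : finType)
    (D : pred J) (M : J -> pred {ffun V -> I}) (b : J -> nat) :
  (forall phi, injective phi -> P (copy phi) ->
     S \subset copy phi /\ exists2 j, D j & M j phi) ->
  (forall j, D j -> (#|[set phi in M j]| <= b j)%N) ->
  \sum_(F in copies | P F) w (F :\: S) <= (\sum_(j | D j) b j)%:R * p ^+ (#|E0| - #|S|).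
Proof.
move=> hP hb.
apply: le_trans (_ : \sum_(F in copies | P F) p ^+ (#|E0| - #|S|) <= _).
  apply: ler_sum => F /andP[Fc PF].
  have /imsetP[phi] := Fc; rewrite inE => /injectiveP phi_inj Fphi.
  have : P (copy phi) by rewrite -Fphi.
  case/(hP _ phi_inj) => SF _; rewrite -Fphi in SF.
  apply: le_trans (mono_weight_le edge_prob01 _ edge_prob_le) _.
  by rewrite cardsD (setIidPr SF) (card_copies Fc).
rewrite sumr_const -[leLHS]mulr_natl ler_wpM2r ?exprn_ge0 // ler_nat.
have sub : [set F in copies | P F] \subset
   \bigcup_(j | D j) [set copy phi | phi in [set phi in M j]].
  apply/subsetP => F; rewrite inE => /andP[/imsetP[phi]].
  rewrite inE => /injectiveP phi_inj -> /(hP _ phi_inj)[_ [j Dj Mj]].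
  apply/bigcupP; exists j => //; apply/imsetP; exists phi => //; by rewrite inE.
rewrite -(cardsE (fun F => (F \in copies) && P F)).
apply: leq_trans (subset_leq_card sub) _.
elim/big_ind2 : _ => [|a1 a2 c1 c2 h1 h2|j Dj]; first by rewrite cards0.
  by apply: leq_trans (leq_card_setU _ _) (leq_add h1 h2).
by apply: leq_trans (leq_imset_card _ _) (hb j Dj).
Qed.

(** Some edge [a] of [E0] is mapped into [K]: its two ends have [#|K|] choices each, the other
    vertices are free. *)
Lemma sum_copies_touching (K : {set I}) :
  \sum_(F in copies | touches (inner_edges K) F) w F <=
  (#|E0| * (#|K| ^ 2 * #|I| ^ (#|V| - 2)))%:R * p ^+ #|E0|.
Proof.
under eq_bigr do rewrite -[X in w X]setD0.
have -> : #|E0| = (#|E0| - #|set0 : {set {set I}}|)%N by rewrite cards0 subn0.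
rewrite {1}cards0 subn0 -sum_nat_const.
apply: (sum_copies_le (P := touches (inner_edges K)) (D := fun a => a \in E0)
  (M := fun (a : {set V}) phi => [forall x in a, phi x \in K])).
  move=> phi phi_inj /touchesP[u /imsetP[a aE ->]]; rewrite inE => /andP[_ /subsetP aK].
  split; first exact: sub0set.
  by exists a => //; apply/forallP => x; apply/implyP => xa; apply: aK; apply: imset_f.
move=> a aE; have := card_maps_le a (fun=> K).
by rewrite prod_nat_const E02.
Qed.

Lemma preim_copy phi S : injective phi -> S \subset copy phi ->
  let S' := [set a in E0 | phi @: a \in S] in
  S = [set phi @: (a : {set V}) | a in S'].
Proof.
move=> phi_inj /subsetP SF /=; apply/setP => u; apply/idP/imsetP => [uS|[a]].
  by have /imsetP[a aE ua] := SF _ uS; exists a => //; rewrite inE aE -ua.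
by rewrite inE => /andP[_ ?] ->.
Qed.

(** Copies are sorted by the preimage [S'] of [S] in [E0]. Vertices of [cover S'] go to [cover S],
    in at most [#|V| ^ #|V|] ways, and the others are free. [Q] records what is known about the
    preimage. *)
Lemma sum_copies_link S (Q : pred {set {set V}}) (P : pred {set {set I}}) (nu : R) :
  (forall phi, injective phi -> P (copy phi) -> S \subset copy phi /\
     Q [set a in E0 | phi @: a \in S]) ->
  (forall S' : {set {set V}}, S' \subset E0 -> Q S' -> #|S'| = #|S| ->
     (#|I| ^ (#|V| - #|cover S'|))%:R * p ^+ (#|E0| - #|S'|) <= nu) ->
  0 <= nu -> (0 < #|V|)%N ->
  \sum_(F in copies | P F) w (F :\: S) <= (2 ^ #|E0| * #|V| ^ #|V|)%:R * nu.
Proof.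
move=> hP hnu nu0 V0.
pose D (S' : {set {set V}}) := [&& S' \subset E0, Q S', #|S'| == #|S| & #|cover S'| ==
  #|cover S|].
pose M (S' : {set {set V}}) phi := [forall x in cover S', phi x \in cover S].
have le := @sum_copies_le P S _ D M
  (fun S' : {set {set V}} => #|V| ^ #|V| * #|I| ^ (#|V| - #|cover S'|))%N.
apply: le_trans (le _ _) _.
- move=> phi phi_inj Pphi; have [SF QS] := hP phi phi_inj Pphi; split=> //.
  have eS := preim_copy phi_inj SF; set S' := [set a in E0 | _] in QS eS.
  have cS : cover S = phi @: cover S'.
    apply/setP => y; apply/bigcupP/imsetP => [[u]|[x /bigcupP[a aS xa] ->]].
      rewrite {1}eS => /imsetP[a aS ->] /imsetP[x xa ->].
      by exists x => //; apply/bigcupP; exists a.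
    exists (phi @: a); last exact: imset_f.
    by move: aS; rewrite inE => /andP[].
  exists S'.
    apply/and4P; split=> //.
    - by apply/subsetP => a; rewrite inE => /andP[].
    - by rewrite eS card_imset //; apply: imset_ffun_inj.
    - by rewrite cS card_imset.
  by apply/forallP => x; apply/implyP => xS; rewrite cS imset_f.
- move=> S' /and4P[_ _ _ /eqP cS'].
  apply: leq_trans (card_maps_le (cover S') (fun=> cover S)) _.
  rewrite prod_nat_const leq_mul2r; apply/orP; right.
  rewrite -cS'; apply: leq_trans (_ : #|V| ^ #|cover S'| <= _)%N.
    have [c0|c0] := posnP #|cover S'|; first by rewrite c0.
    by rewrite leq_exp2r ?max_card.
  by rewrite leq_pexp2l // max_card.
rewrite natr_sum mulr_suml.
apply: le_trans (_ : \sum_(S' | D S') (#|V| ^ #|V|)%:R * nu <= _).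
  apply: ler_sum => S' /and4P[SE QS /eqP cS _].
  by rewrite natrM -mulrA ler_wpM2l // -cS; apply: hnu.
rewrite sumr_const -[leLHS]mulr_natl natrM -mulrA ler_wpM2r ?mulr_ge0 // ler_nat.
rewrite -card_powerset; apply: subset_leq_card; apply/subsetP => S' /and4P[SE _ _ _].
by rewrite inE.
Qed.

Lemma sum_copies_link2 S nu :
  (forall S' : {set {set V}}, S' \proper E0 -> (2 <= #|S'|)%N ->
     (#|I| ^ (#|V| - #|cover S'|))%:R * p ^+ (#|E0| - #|S'|) <= nu) ->
  0 <= nu -> (0 < #|V|)%N -> (2 <= #|S|)%N ->
  \sum_(F in copies | S \proper F) w (F :\: S) <= (2 ^ #|E0| * #|V| ^ #|V|)%:R * nu.
Proof.
move=> hnu nu0 V0 S2.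
apply: (@sum_copies_link S (fun S' : {set {set V}} => S' \proper E0) (fun F => S \proper
  F) nu) => //; last first.
  by move=> S' _ pS' cS'; apply: hnu; rewrite // cS'.
move=> phi phi_inj pS; have SF := proper_sub pS; split=> //.
have eS := preim_copy phi_inj SF; set S' := [set a in E0 | _] in eS *.
have SE : S' \subset E0 by apply/subsetP => a; rewrite inE => /andP[].
rewrite properEneq SE andbT; apply: contraTneq pS => SE'.
by rewrite eS SE' properxx.
Qed.

Lemma sum_copies_link1 u nu :
  (#|I| ^ (#|V| - 2))%:R * p ^+ (#|E0| - 1) <= nu ->
  0 <= nu -> (0 < #|V|)%N ->
  \sum_(F in copies | u \in F) w (F :\ u) <= (2 ^ #|E0| * #|V| ^ #|V|)%:R * nu.
Proof.
move=> hnu nu0 V0.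
apply: (@sum_copies_link [set u] xpredT (fun F => u \in F) nu) => // [phi phi_inj uF|S'
  SE _].
  by rewrite sub1set uF.
rewrite cards1 => /eqP/cards1P[a Sa].
have aE : a \in E0 by rewrite -sub1set -Sa.
by rewrite Sa /cover big_set1 E02 // cards1.
Qed.

(** The second edge, inside [K], has an end [x] outside the edge [a] mapped to [u]. So [x] has
    [#|K|] choices, the ends of [a] at most 4 together, and [#|V| - 3] vertices are free. *)
Lemma sum_copies_touching1 u (K : {set I}) nu :
  #|K|%:R * (#|I| ^ (#|V| - 3))%:R * p ^+ (#|E0| - 1) <= nu -> 0 <= nu ->
  \sum_(F in copies | (u \in F) && touches (inner_edges K) (F :\ u)) w (F :\ u)
    <= (4 * (#|E0| * #|V|))%:R * nu.
Proof.
move=> hnu nu0.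
pose D (ax : {set V} * V) := (ax.1 \in E0) && (ax.2 \notin ax.1) && (#|u| == 2%N).
pose M (ax : {set V} * V) phi := [forall x in ax.2 |: ax.1,
   phi x \in if x == ax.2 then K else u].
have le := @sum_copies_le
  (fun F => (u \in F) && touches (inner_edges K) (F :\ u)) [set u] _ D M
  (fun _ => 4 * (#|K| * #|I| ^ (#|V| - 3)))%N.
apply: le_trans (le _ _) _.
- move=> phi phi_inj /andP[uF /touchesP[f fF fB]]; split; first by rewrite sub1set.
  move: fF; rewrite in_setD1 => /andP[fu /imsetP[a' aE' fa']].
  move: fB; rewrite inE => /andP[_ fK].
  have /imsetP[a aE ua] := uF.
  have /subsetPn[x xa' xa] : ~~ (a' \subset a).
    apply: contra fu => sa; rewrite fa' ua.
    by have /eqP-> : (a' : {set V}) == a by rewrite eqEcard sa !E02.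
  exists (a, x).
    by rewrite /D /= aE xa ua card_imset // E02.
  apply/forallP => y; apply/implyP; rewrite /= in_setU1.
  case: eqP => [-> _|_ /= ya]; last by rewrite ua imset_f.
  by apply: (subsetP fK); rewrite fa' imset_f.
- move=> [a x]; rewrite /D /= => /andP[/andP[aE xa] /eqP u2].
  apply: leq_trans (card_maps_le (x |: a) (fun y => if y == x then K else u)) _.
  rewrite big_setU1 //= eqxx cardsU1 xa E02 //.
  rewrite (eq_bigr (fun=> 2%N)) => [|y ya]; last first.
    by case: eqP => [yx|]; [rewrite -yx ya in xa|].
  by rewrite prod_nat_const E02 // [(#|K| * _)%N]mulnC mulnA.
have cD : (#|D| <= #|E0| * #|V|)%N.
  rewrite -cardsT -cardsX; apply: subset_leq_card; apply/subsetP => -[a x].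
  by rewrite !inE => /andP[/andP[-> _] _].
rewrite sum_nat_const cards1.
apply: le_trans (_ : (#|E0| * #|V| * (4 * (#|K| * #|I| ^ (#|V| - 3))))%:R * p ^+ (#|E0| -
  1) <= _).
  by rewrite ler_wpM2r ?exprn_ge0 // ler_nat leq_mul2r cD orbT.
rewrite mulnA [(_ * 4)%N]mulnC natrM -mulrA ler_wpM2l //.
by rewrite natrM.
Qed.

End Copies.

(** * Binomial random graphs and 2-balancedness *)

Lemma eset_card2 (T : finType) (G : graph T) e : e \in eset G -> #|e| = 2%N.
Proof. by move=> eG; have /forallP/(_ e) := valP G; rewrite eG => /andP[_ /eqP]. Qed.

Lemma eset_sub (T : finType) (G : graph T) e : e \in eset G -> e \subset vset G.
Proof. by move=> eG; have /forallP/(_ e) := valP G; rewrite eG => /andP[]. Qed.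

Section GnpPr.
Variables (R : realType) (n : nat) (p : R).
Hypotheses (p0 : 0 <= p) (p1 : p <= 1).
Local Notation U := {set 'I_n}.
Local Notation q := (@edge_prob 'I_n R p).
Let q01 := @edge_prob01 'I_n R p p0 p1.

Lemma eset_weight (G : graph 'I_n) :
  \prod_(e : U | #|e| == 2%N) (if e \in eset G then p else 1 - p) = subset_weight q (eset
    G).
Proof.
rewrite /subset_weight big_mkcond; apply: eq_bigr => u _; rewrite /edge_prob.
case: eqP => // u2; case: ifP => [/eset_card2|]; first by move/u2.
by rewrite subr0.
Qed.

Definition spanning_esets : {set {set U}} :=
  [set eset G | G in [set G : graph 'I_n | vset G == [set: 'I_n]]].

(** Such a set contains an element that is not a pair, which has probability 0. *)
Lemma subset_weight_eq0 (E : {set U}) : E \notin spanning_esets -> subset_weight q E = 0.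
Proof.
move=> EN; have [gE|] := boolP (is_graph ([set: 'I_n], E)).
  by move/imsetP: EN => []; exists (Graph gE); rewrite // inE.
rewrite negb_forall => /existsP[u]; rewrite negb_imply finset.subsetT /= => /andP[uE u2].
by rewrite /subset_weight (bigD1 u) //= uE /edge_prob (negPf u2) mul0r.
Qed.

Lemma sum_spanning (P : pred {set U}) :
  \sum_(G : graph 'I_n | (vset G == [set: 'I_n]) && P (eset G)) subset_weight q (eset G) =
  Pr q P.
Proof.
rewrite /Pr [RHS](bigID (mem spanning_esets)) /= [X in _ + X]big1 ?addr0; last first.
  by move=> E /andP[_ /subset_weight_eq0].
under [RHS]eq_bigl do rewrite andbC.
rewrite [RHS]big_mkcondr big_imset /=; last first.
  move=> G1 G2; rewrite !inE => /eqP v1 /eqP v2 e12; apply/val_inj.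
  by rewrite [LHS]surjective_pairing [RHS]surjective_pairing -/(vset _) -/(eset _) v1 e12
    -v2.
rewrite -big_mkcondr; apply: eq_bigl => G; by rewrite inE.
Qed.

Lemma gnp_prob_bounds (A : graph 'I_n -> Prop) (bad : pred {set U}) :
  (forall G : graph 'I_n, vset G = [set: 'I_n] -> ~~ bad (eset G) -> A G) ->
  1 - Pr q bad <= gnp_prob p A <= 1.
Proof.
move=> hA; rewrite /gnp_prob; under eq_bigr do rewrite eset_weight.
have w0 E := subset_weight_ge0 q01 E.
apply/andP; split; last first.
  rewrite -(Pr_setT q) -sum_spanning [leRHS](bigID (fun G => `[< A G >])) /=.
  under [X in _ <= X + _]eq_bigl do rewrite andbT.
  by rewrite ler_wpDr // sumr_ge0.
have -> : 1 - Pr q bad = Pr q (predC bad).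
  by rewrite -(Pr_setT q) /Pr (bigID bad) /= addrAC subrr add0r.
rewrite -sum_spanning [leRHS](bigID (fun G => ~~ bad (eset G))) /=.
rewrite ler_wpDr ?sumr_ge0 // le_eqVlt; apply/orP; left; apply/eqP/eq_bigl => G.
case: eqP => //= vG; case: (boolP (bad _)) => // nb; rewrite ?andbF // andbT.
by apply/esym/asboolP/hA.
Qed.

Lemma gnp_prob_le (A B : graph 'I_n -> Prop) :
  (forall G, A G -> B G) -> gnp_prob p A <= gnp_prob p B.
Proof.
move=> AB; rewrite /gnp_prob [leRHS](bigID (fun G => `[< A G >])) /= ler_wpDr //.
  by apply: sumr_ge0 => G _; rewrite eset_weight subset_weight_ge0.
rewrite le_eqVlt; apply/orP; left; apply/eqP/eq_bigl => G.
case: (vset G == _) => //=; case: (asboolP (A G)) => [/AB/asboolP -> //|]; by rewrite andbF.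
Qed.

End GnpPr.

(** * Densities of edge sets in a strictly 2-balanced graph *)

Section Abstract.
Variables (T : finType) (H : graph T).
Local Notation V := {x : T | x \in vset H}.

(** The edges of [H] over the type of its own vertices, so that this type has exactly [#|vset H|]
    elements. *)
Definition abstract_edges : {set {set V}} := [set a : {set V} | val @: a \in eset H].

Lemma abstract_edges2 : {in abstract_edges, forall a : {set V}, #|a| = 2%N}.
Proof.
move=> a; rewrite inE => /eset_card2; rewrite card_imset //; exact: val_inj.
Qed.

Lemma cards2E (I : finType) (a : {set I}) : #|a| = 2%N -> exists x y, a = [set x; y].
Proof. by move=> /eqP/cards2P[x [y [_ ->]]]; exists x, y. Qed.

Lemma imset_set2 (I J : finType) (f : I -> J) x y : f @: [set x; y] = [set f x; f y].
Proof. by rewrite imsetU1 imset_set1. Qed.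

Lemma iso_copy (n : nat) (F : graph 'I_n) : isomorphic H F ->
  eset F \in copies abstract_edges 'I_n.
Proof.
case=> f [f_bij fE]; have [g gK fK] := f_bij.
pose phi : {ffun V -> 'I_n} := [ffun x => val (f x)].
apply/imsetP; exists phi.
  rewrite inE; apply/injectiveP => x y; rewrite !ffunE => /val_inj.
  exact: (bij_inj f_bij).
apply/setP => e; apply/idP/imsetP => [eF|[a]].
  have [y1 [y2 ey]] := cards2E (eset_card2 eF).
  have sub := eset_sub eF; rewrite ey subUset !sub1set in sub.
  case/andP: sub => h1 h2.
  pose x1 := g (exist _ y1 h1); pose x2 := g (exist _ y2 h2).
  have e1 : val (f x1) = y1 by rewrite fK.
  have e2 : val (f x2) = y2 by rewrite fK.
  exists [set x1; x2]; last by rewrite imset_set2 !ffunE e1 e2.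
  by rewrite inE imset_set2 fE e1 e2 -ey.
rewrite inE => aH ->; have [x [y axy]] : exists x y, a = [set x; y].
  by apply/cards2E/abstract_edges2; rewrite inE.
by move: aH; rewrite axy !imset_set2 !ffunE fE.
Qed.

Lemma card_abstract_edges : #|abstract_edges| = #|eset H|.
Proof.
have -> : eset H = [set val @: (a : {set V}) | a in abstract_edges].
  apply/setP => e; apply/idP/imsetP => [eH|[a]]; last by rewrite inE => ? ->.
  have ve : e = val @: [set x : V | val x \in e].
    apply/setP => x; apply/idP/imsetP => [xe|[y]]; last by rewrite inE => ? ->.
    have xH := subsetP (eset_sub eH) _ xe.
    by exists (exist _ x xH); rewrite ?inE.
  by exists [set x : V | val x \in e]; rewrite // inE -ve.
by rewrite card_imset //; apply/imset_inj/val_inj.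
Qed.

Lemma cover_val (S : {set {set V}}) :
  cover [set val @: (a : {set V}) | a in S] = val @: cover S.
Proof.
apply/setP => y; apply/bigcupP/imsetP => [[u /imsetP[a aS ->] /imsetP[x xa ->]]|].
  by exists x => //; apply/bigcupP; exists a.
by case=> x /bigcupP[a aS xa] ->; exists (val @: a); apply: imset_f.
Qed.

Variable R : realType.
Hypothesis Hbal : strictly_2balanced R H.
Hypothesis Hd : 1 < m2 R H.

(** Otherwise [density2] would be below [m2 R H] on [H] and, by balancedness, on each proper
    subgraph, and so would the default 0; the maximum would be below itself. *)
Lemma m2_density : m2 R H = density2 R H.
Proof.
apply/eqP; rewrite eq_le le_bigmax_cond ?andbT /subgraph ?subxx //.
rewrite leNgt; apply/negP => lt; suff : m2 R H < m2 R H by rewrite ltxx.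
apply: bigmax_lt; first exact: lt_trans Hd.
move=> F sF; have [->//|nF] := eqVneq F H.
have pF : proper_subgraph F H by rewrite /proper_subgraph nF andbT.
apply: le_lt_trans (Hbal pF).
by apply: le_bigmax_cond; rewrite /subgraph !subxx.
Qed.

(** A value above 1 rules out the values 0 and 1/2 that [density2] takes on graphs with at most two
    vertices. *)
Lemma m2E : [/\ (3 <= #|vset H|)%N, (2 <= #|eset H|)%N &
  m2 R H * (#|vset H|%:R - 2) = #|eset H|%:R - 1].
Proof.
have [v3|v3] := leqP 3 #|vset H|; last first.
  move: Hd; rewrite m2_density /density2 leqNgt v3 /= mul0r add0r.
  by case: (_ && _); rewrite /= ?mul0r ?mul1r; lra.
have v2 : 0 < #|vset H|%:R - 2 :> R by rewrite subr_gt0 ltr_nat.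
have dE : m2 R H = (#|eset H|%:R - 1) / (#|vset H|%:R - 2).
  rewrite m2_density /density2 v3 mul1r [_ == 2%N]gtn_eqF //.
  by rewrite /= mulr1n mul1r mulr0n mul0r addr0.
split=> //; last by rewrite dE divfK ?gt_eqF.
have : 0 < (#|eset H|%:R - 1 : R) by rewrite -(pmulr_lgt0 _ (_ : 0 < (#|vset H|%:R -
  2)^-1)) ?invr_gt0 // -dE (lt_trans _ Hd).
by rewrite subr_gt0 ltr1n.
Qed.

Lemma card2_cover (S : {set {set V}}) : S \subset abstract_edges -> (2 <= #|S|)%N ->
  (3 <= #|cover S|)%N.
Proof.
move=> SE /card_gt1P[a [b [aS bS nab]]].
have a2 := abstract_edges2 (subsetP SE _ aS); have b2 := abstract_edges2 (subsetP SE _ bS).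
rewrite ltnNge; apply: contra nab => c2.
have ca : a = cover S by apply/eqP; rewrite eqEcard bigcup_sup ?a2.
have cb : b = cover S by apply/eqP; rewrite eqEcard bigcup_sup ?b2.
by rewrite ca cb.
Qed.

(** Strict balancedness for the subgraph with edge set [S] and no isolated vertices. *)
Lemma m2_gt_sub (S : {set {set V}}) : S \proper abstract_edges -> (2 <= #|S|)%N ->
  #|S|%:R - 1 < m2 R H * (#|cover S|%:R - 2).
Proof.
move=> pS S2; have SE := proper_sub pS.
have c3 := card2_cover SE S2.
pose S1 := [set val @: (a : {set V}) | a in S].
have S1E : S1 \subset eset H.
  by apply/subsetP => e /imsetP[a /(subsetP SE)]; rewrite inE => aE ->.
have gS : is_graph (cover S1, S1).
  apply/forallP => e; apply/implyP => /= eS; rewrite bigcup_sup //=.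
  by apply/eqP/(@eset_card2 _ H)/(subsetP S1E).
have cS1 : #|S1| = #|S| by rewrite card_imset //; apply/imset_inj/val_inj.
have ccS1 : #|cover S1| = #|cover S| by rewrite cover_val card_imset //; apply: val_inj.
have v2 : 0 < #|cover S|%:R - 2 :> R by rewrite subr_gt0 ltr_nat.
rewrite -ltr_pdivrMr //.
have -> : (#|S|%:R - 1) / (#|cover S|%:R - 2) = density2 R (Graph gS).
  rewrite /density2 /vset /eset /= cS1 ccS1 c3 mul1r [_ == 2%N]gtn_eqF //.
  by rewrite /= mulr1n mul1r mulr0n mul0r addr0.
suff pF : proper_subgraph (Graph gS) H.
  by apply: le_lt_trans (Hbal pF); apply: le_bigmax_cond; rewrite /subgraph !subxx.
apply/andP; split.
  rewrite /subgraph /vset /eset /= S1E andbT; apply/subsetP => y /bigcupP[e eS1].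
  by apply/subsetP/eset_sub/(subsetP S1E).
apply: contraTneq (proper_card pS) => HS.
by rewrite -cS1 card_abstract_edges -HS /eset /= ltnn.
Qed.

End Abstract.

(** * The bound for fixed n and k *)

Section FiniteBound.
Variables (R : realType) (T : finType) (H : graph T).
Local Notation E0 := (abstract_edges H).
Local Notation v := #|vset H|.
Local Notation e := #|eset H|.

Lemma X_E n (G : graph 'I_n) (K : {set 'I_n}) :
  X_ G K = #|eset G :&: inner_edges K|.
Proof.
rewrite /X_ /induced_edges; apply: eq_card => u; rewrite !inE.
by case: (boolP (u \in eset G)) => //= /eset_card2 ->; rewrite eqxx.
Qed.

Lemma Y_le n (G : graph 'I_n) (K : {set 'I_n}) :
  (Y_ H G K <= #|covered (copies E0 'I_n) (inner_edges K) (eset G)|)%N.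
Proof.
apply: subset_leq_card; apply/subsetP => u; rewrite !inE => /andP[/andP[uG uK]].
move=> /asboolP[F [[/andP[_ FG] iF] uF]].
rewrite uG uK (eset_card2 uG) eqxx /=; apply/existsP; exists (eset F).
by rewrite iso_copy // FG uF.
Qed.

Lemma card_inner_edges n (K : {set 'I_n}) : #|inner_edges K| = 'C(#|K|, 2).
Proof.
by rewrite -cards_draws; apply: eq_card => u; rewrite !inE andbC.
Qed.

(** [Pr_covered] for copies of [H] and the pairs inside [k]-sets. [A] controls extensions of one
    edge, [nu] those of larger kernels or with a further vertex in [K]; [Q] absorbs the
    combinatorial constants, and [mu] bounds the expected number of copies with an edge in [K]. *)
Lemma gnp_event_bounds (n k : nat) (p z nu A delta Q mu : R) (s m L r t b : nat) :
  (2 <= e)%N -> (0 < v)%N -> 0 <= p -> p <= 1 -> 0 < z -> z <= 1 -> (0 < L)%N ->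
  0 <= nu -> 0 <= A ->
  (forall S : {set {set _}}, S \proper E0 -> (2 <= #|S|)%N ->
     (n ^ (v - #|cover S|))%:R * p ^+ (e - #|S|) <= nu) ->
  (n ^ (v - 2))%:R * p ^+ (e - 1) <= A ->
  k%:R * (n ^ (v - 3))%:R * p ^+ (e - 1) <= nu ->
  (s * e + (m * (2 * e) + m * (2 * e) * e) * (r * e * (L * e) ^ e * e) <= b)%N ->
  b%:R <= delta * 'C(k, 2)%:R * p ->
  (1 - delta) * 'C(k, 2)%:R * p <= t.+1%:R ->
  Q = (2 ^ e * v ^ v + 4 * (e * v))%:R ->
  mu = e%:R * k%:R ^+ 2 * p * A ->
  1 - ((n ^ k)%:R * (mu ^+ s / s`!%:R + (mu * (2 ^+ e * (Q * nu))) ^+ m / m`!%:R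
                  + (1 - p * (1 - z)) ^+ 'C(k, 2) / z ^+ t)
       + (n ^ v * 2 ^ e)%:R * (Q * nu) ^+ L + (n ^ 2)%:R * ((Q * A) ^+ r / r`!%:R))
  <= gnp_prob p (fun G : graph 'I_n => forall K : {set 'I_n}, #|K| = k ->
         (Y_ H G K)%:R <= delta * 'C(k, 2)%:R * p /\
         (1 - delta) * 'C(k, 2)%:R * p <= (X_ G K)%:R) <= 1.
Proof.
move=> e2 v0 p0 p1 z0 z1 L0 nu0 A0 hnu hA hnu1 hb hY hX QE muE.
have cV : #|{: {x : T | x \in vset H}}| = v by rewrite card_sig; apply: eq_card.
have cE := card_abstract_edges H.
have E02 := @abstract_edges2 T H.
pose HH := copies E0 'I_n.
pose BB : {set {set {set 'I_n}}} := [set inner_edges K | K in [set K : {set 'I_n} | #|K|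
  == k]].
pose bad (E : {set {set 'I_n}}) := [exists B in BB, (b < #|covered HH B E|)%N || (#|E :&:
  B| <= t)%N].
have /andP[lo ->] : 1 - Pr (edge_prob p) bad <= gnp_prob p (fun G : graph 'I_n => forall
  K : {set 'I_n}, #|K| = k ->
         (Y_ H G K)%:R <= delta * 'C(k, 2)%:R * p /\
         (1 - delta) * 'C(k, 2)%:R * p <= (X_ G K)%:R) <= 1.
  apply: gnp_prob_bounds => // G _ nbad K Kk.
  have : inner_edges K \in BB by apply: imset_f; rewrite inE Kk.
  move=> KB; move: nbad; rewrite negb_exists => /forallP/(_ (inner_edges K)).
  rewrite KB /= negb_or -leqNgt -ltnNge => /andP[cb ct].
  split; first by apply: le_trans hY; rewrite ler_nat (leq_trans (Y_le _ _)).
  by apply: le_trans hX _; rewrite ler_nat X_E.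
rewrite andbT; apply: le_trans lo; rewrite lerD2l lerN2.
have Q0 : 0 <= Q by rewrite QE.
have le1 : (2 ^ e * v ^ v)%:R <= Q by rewrite QE ler_nat leq_addr.
have le2 : (4 * (e * v))%:R <= Q by rewrite QE ler_nat leq_addl.
have hmu B : B \in BB -> \sum_(F in HH | touches B F) mono_weight (edge_prob p) F <= mu.
  case/imsetP => K; rewrite inE => /eqP Kk ->.
  apply: le_trans (sum_copies_touching E02 p0 p1 K) _.
  rewrite cE cV card_ord Kk muE.
  have -> : p ^+ e = p ^+ (e - 1) * p by rewrite -exprSr subn1 prednK // ltnW.
  have -> : (e * (k ^ 2 * n ^ (v - 2)))%:R * (p ^+ (e - 1) * p) =
            e%:R * k%:R ^+ 2 * p * ((n ^ (v - 2))%:R * p ^+ (e - 1)).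
    by rewrite natrM (natrM _ (k ^ 2)) (natrX _ k); move: (_%:R) (_%:R) (p ^+ _) (_ ^+ 2)
      => ? ? ? ?; ring.
  by rewrite ler_wpM2l ?mulr_ge0 ?exprn_ge0.
have hN B : B \in BB -> #|B| = 'C(k, 2) /\ {in B, forall u, edge_prob p u = p}.
  case/imsetP => K; rewrite inE => /eqP Kk ->; split; first by rewrite card_inner_edges Kk.
  by move=> u; rewrite inE /edge_prob => /andP[-> _].
apply: le_trans (@Pr_covered R {set 'I_n} (edge_prob p) (edge_prob01 p0 p1) HH e _ BB mu
  (Q * nu) (Q * A) p z 'C(k, 2) s m L r t b L0 e2 z0 z1 _ hN _ _ _ hmu hb) _.
- by rewrite -cE; apply: card_copies.
- by rewrite mulr_ge0.
- move=> S S2; apply: le_trans (sum_copies_link2 p0 p1 (nu := nu) _ nu0 _ S2) _.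
  + by move=> S' S'E S'2; rewrite cE cV card_ord; apply: hnu.
  + by rewrite cV.
  + by rewrite cE cV ler_wpM2r.
- move=> u; apply: le_trans (sum_copies_link1 E02 p0 p1 u (nu := A) _ A0 _) _.
  + by rewrite cE cV card_ord.
  + by rewrite cV.
  + by rewrite cE cV ler_wpM2r.
- move=> B u /imsetP[K]; rewrite inE => /eqP Kk ->.
  apply: le_trans (sum_copies_touching1 E02 p0 p1 u (K := K) (nu := nu) _ nu0) _.
  + by rewrite cE cV card_ord Kk.
  + by rewrite cE cV ler_wpM2r.
have mu0 : 0 <= mu by rewrite muE !mulr_ge0 ?exprn_ge0.
have pz : 0 <= 1 - p * (1 - z).
  have : p * (1 - z) <= 1 * 1 by rewrite ler_pM // ?subr_ge0 // gerBl ltW.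
  by rewrite mulr1 subr_ge0.
apply: lerD; first apply: lerD.
- rewrite ler_wpM2r ?addr_ge0 ?divr_ge0 ?exprn_ge0 ?mulr_ge0 ?exprn_ge0 // ?(ltW z0) //.
  rewrite ler_nat; apply: leq_trans (leq_imset_card _ _) _.
  apply: leq_trans (bin_leq_exp n k); rewrite -[n in 'C(n, _)]card_ord -card_draws.
  by rewrite leqnn.
- rewrite ler_wpM2r ?exprn_ge0 ?mulr_ge0 // ler_nat leq_mul2r; apply/orP; right.
  by apply: leq_trans (leq_card_copies _ _) _; rewrite card_ord cV.
- rewrite ler_wpM2r ?divr_ge0 ?exprn_ge0 ?mulr_ge0 // ler_nat.
  by apply: leq_trans (leq_card_cover_copies E02 _) _; rewrite card_ord.
Qed.

End FiniteBound.

(** * Real estimates *)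

Section RealBounds.
Variable R : realType.
Implicit Types (mu M x y : R).

Lemma exprn_fact_le x n : 0 <= x -> x ^+ n / n`!%:R <= expR x.
Proof.
move=> x0; case: n => [|n].
  by rewrite expr0 fact0 divr1 -expR0 ler_expR.
by apply: le_trans (expR_ge1Dxn n x0); rewrite lerDr.
Qed.

(** From [s ^ s / s! <= expR s]; the extra 1 in the exponent absorbs this factor. *)
Lemma exprn_fact_decay mu M (s : nat) : 0 <= mu -> mu <= s%:R * expR (- (M + 1)) ->
  mu ^+ s / s`!%:R <= expR (- (M * s%:R)).
Proof.
move=> mu0 hmu.
apply: le_trans (_ : (s%:R * expR (- (M + 1))) ^+ s / s`!%:R <= _).
  by rewrite ler_wpM2r ?invr_ge0 // lerXn2r ?nnegrE ?mulr_ge0 ?expR_ge0.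
rewrite exprMn mulrAC -expRM_natr.
apply: le_trans (ler_wpM2r (expR_ge0 _) (exprn_fact_le s (ler0n _ s))) _.
by rewrite -expRD ler_expR; lra.
Qed.

Lemma truncn_half x : 1 <= x -> x / 2 <= (Num.trunc x)%:R <= x.
Proof.
move=> x1; have x0 : 0 <= x by lra.
have /andP[t1 t2] := truncn_itv x0; rewrite t1 andbT.
have : (1 <= Num.trunc x)%N by rewrite truncn_gt0.
rewrite -(ler1n R) -natr1 in t2 *; lra.
Qed.

Lemma powers_le (n a b : nat) (c C d y p : R) : 0 <= c -> 0 <= C ->
  n%:R <= c * expR (d * y) -> p = C * expR (- y) ->
  (n ^ a)%:R * p ^+ b <= c ^+ a * C ^+ b * expR ((d * a%:R - b%:R) * y).
Proof.
move=> c0 C0 hn ->; rewrite natrX exprMn.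
have -> : expR ((d * a%:R - b%:R) * y) = expR (d * y) ^+ a * expR (- y) ^+ b.
  by rewrite -!expRM_natr -expRD; congr expR; ring.
have hna : n%:R ^+ a <= c ^+ a * expR (d * y) ^+ a.
  by rewrite -exprMn lerXn2r ?nnegrE ?mulr_ge0 ?expR_ge0.
rewrite [leRHS]mulrACA; apply: ler_wpM2r hna.
by rewrite mulr_ge0 ?exprn_ge0 ?expR_ge0.
Qed.

Lemma oneB_le_expR x : 1 - x <= expR (- x).
Proof. by have := expR_ge1Dx (- x); lra. Qed.

(* [z = expR (- delta / 2)] in the exponential Markov inequality; only
   [expR (- u) <= 1 / (1 + u)] is needed. *)
Lemma chernoff_le (p delta : R) (N t : nat) : 0 <= p -> p <= 1 -> 0 < delta ->
  t%:R <= (1 - delta) * N%:R * p ->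
  (1 - p * (1 - expR (- (delta / 2)))) ^+ N / expR (- (delta / 2)) ^+ t
    <= expR (- (delta ^+ 2 / 4 * (N%:R * p))).
Proof.
move=> p0 p1 d0 ht; set z := expR _.
have z1 : z <= 1 by rewrite -expR0 ler_expR; lra.
have z0 : 0 < z := expR_gt0 _.
have zd : delta / 2 - delta ^+ 2 / 4 <= 1 - z.
  have h : z * (1 + delta / 2) <= 1.
    rewrite /z expRN mulrC ler_pdivrMr ?expR_gt0 // mul1r; exact: expR_ge1Dx.
  have h2 : z <= (1 + delta / 2)^-1 by rewrite -[leRHS]mul1r ler_pdivlMr //; lra.
  apply: le_trans (_ : 1 - (1 + delta / 2)^-1 <= _); last by lra.
  have -> : 1 - (1 + delta / 2)^-1 = (delta / 2) / (1 + delta / 2) by field; lra.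
  rewrite ler_pdivlMr; last by lra.
  have : 0 <= delta ^+ 3 by rewrite exprn_ge0 // ltW.
  rewrite !exprS expr0; nra.
have h1 : (1 - p * (1 - z)) ^+ N <= expR (- (p * (1 - z) * N%:R)).
  have -> : expR (- (p * (1 - z) * N%:R)) = expR (- (p * (1 - z))) ^+ N.
    by rewrite -expRM_natr mulNr.
  rewrite lerXn2r ?nnegrE ?expR_ge0 ?oneB_le_expR // subr_ge0.
  by rewrite mulr_ile1 //; lra.
have h2 : (z ^+ t)^-1 = expR (delta / 2 * t%:R).
  by rewrite /z -expRM_natr -expRN mulNr opprK.
rewrite h2; apply: le_trans (ler_wpM2r (expR_ge0 _) h1) _.
rewrite -expRD ler_expR.
have e1 : delta / 2 * t%:R <= delta / 2 * ((1 - delta) * N%:R * p) by rewrite ler_wpM2l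
  // ltW // divr_gt0.
have e2 : (delta / 2 - delta ^+ 2 / 4) * (N%:R * p) <= (1 - z) * (N%:R * p).
  by rewrite ler_wpM2r // mulr_ge0.
move: e1 e2; rewrite !expr2; lra.
Qed.

Lemma natr_bin2 (k : nat) : (0 < k)%N -> 'C(k, 2)%:R = k%:R * (k%:R - 1) / 2 :> R.
Proof.
move=> k0; have -> : k%:R - 1 = k.-1%:R :> R by rewrite -subn1 natrB.
rewrite -natrM -[(k * k.-1)%N]odd_double_half oddM -subn1 oddB //=.
rewrite bin2 addbT andbN add0n -muln2 natrM mulfK ?pnatr_eq0 //.
by rewrite subn1.
Qed.

Lemma half_pairs_ge (w K : R) : 0 <= w -> 2 <= K -> w * K / 4 <= w * (K - 1) / 2.
Proof.
move=> w0 K2; have : 0 <= w * (K - 2) by rewrite mulr_ge0 // subr_ge0.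
lra.
Qed.

(** Each of the two summands is at most [delta * C * k * l / 8], half of the budget. *)
Lemma budget_le (delta C l k s e r kap eta Np : R) :
  0 < e -> 0 < delta -> 1 <= C -> 0 < k -> 0 < l -> 0 <= kap ->
  s <= delta * C * k * l / (8 * e) -> r <= eta * l -> 8 * kap * eta <= delta ->
  C * l * k / 4 <= Np -> s * e + kap * k * r <= delta * Np.
Proof.
move=> e0 delta0 C1 k0 l0 kap0 s_le r_le hkap Np_ge.
have b1 : s * e <= delta * C * k * l / 8.
  apply: le_trans (ler_wpM2r (ltW e0) s_le) _.
  by rewrite le_eqVlt; apply/orP; left; apply/eqP; field; rewrite gt_eqF.
have b3 : kap * k * r <= kap * k * (eta * l) by rewrite ler_wpM2l // mulr_ge0 // ltW.
have b4 : 8 * kap * eta * (k * l) <= delta * (k * l) by rewrite ler_wpM2r // mulr_ge0 //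
  ltW.
have b5 : 0 <= (C - 1) * (delta * k * l) by rewrite !mulr_ge0 //; lra.
have b6 := ler_wpM2l (ltW delta0) Np_ge.
lra.
Qed.

(** Small [c] makes [mu] at most [s * expR (- (M + 1))], and [M * s] is at least [(d + 1) * k * l].
    The factor [expR (- (d * l * k))] is there to cancel the number [n ^ k] of sets [K]. *)
Lemma many_copies_le (mu M d delta C c l k e X : R) (s : nat) :
  0 <= mu -> 0 < e -> 0 < delta -> 1 <= C -> 0 < d -> 0 < k -> 0 < l -> l <= k * l ->
  M = (d + 1) * 16 * e / delta ->
  mu = e * C * (c * X) * (k * l) -> delta * C * k * l / (8 * e) / 2 <= s%:R ->
  c * (16 * e ^+ 2 * X) <= delta * expR (- (M + 1)) ->
  mu ^+ s / s`!%:R <= expR (- (d * l * k)) * expR (- l).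
Proof.
move=> mu0 e0 delta0 C1 d0 k0 l0 kl ME muE s_ge hc.
have M0 : 0 <= M by rewrite ME divr_ge0 ?mulr_ge0 //; lra.
have step1 : mu <= s%:R * expR (- (M + 1)).
  have C0 : 0 < C by lra.
  apply: le_trans (ler_wpM2r (expR_ge0 _) s_ge).
  have -> : mu = C * k * l / (16 * e) * (c * (16 * e ^+ 2 * X)).
    by rewrite muE; field; rewrite gt_eqF.
  have -> : delta * C * k * l / (8 * e) / 2 * expR (- (M + 1)) =
            C * k * l / (16 * e) * (delta * expR (- (M + 1))).
    by field; rewrite gt_eqF.
  by rewrite ler_wpM2l // divr_ge0 // !mulr_ge0 // ltW.
apply: le_trans (exprn_fact_decay mu0 step1) _.
rewrite -expRD ler_expR.
have h1 := ler_wpM2l M0 s_ge.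
have h2 : M * (delta * C * k * l / (8 * e) / 2) = (d + 1) * (C * (k * l)).
  by rewrite ME; field; rewrite !gt_eqF.
have kl0 : 0 < k * l by rewrite mulr_gt0.
have h3 : 0 <= (d + 1) * ((C - 1) * (k * l)).
  by rewrite !mulr_ge0 ?(ltW kl0) //; lra.
lra.
Qed.

(** The expected number of clusters is polynomially smaller than [k], so each of the [D * k]
    disjoint clusters contributes a factor [expR (- (eps / 2 * l))]; the choice of [D] then beats
    [n ^ k]. *)
Lemma many_clusters_le (mu nu d eps C c l k e X P y Q : R) (D m : nat) :
  0 <= mu -> 0 <= nu -> 0 <= Q -> 0 <= P ->
  0 <= c -> c <= 1 -> 0 <= X -> 0 <= e -> 1 <= C -> 0 < k -> 0 < l -> l <= k * l ->
  m%:R = D%:R * k -> (0 < D)%N -> 2 * (d + 1) <= eps * D%:R ->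
  mu = e * C * (c * X) * (k * l) -> nu = X * expR (- (eps * y)) ->
  expR 1 * e * (C * X) * P * Q * X * l * expR (- (eps * y)) <= expR (- (eps / 2 * l)) ->
  (mu * (P * (Q * nu))) ^+ m / m`!%:R <= expR (- (d * l * k)) * expR (- l).
Proof.
move=> mu0 nu0 Q0 P0 c0 c1 X0 e0 C1 k0 l0 kl mE D0 hD muE nuE By.
have C0 : 0 <= C by lra.
have step1 : mu * (P * (Q * nu)) <= m%:R * expR (- (eps / 2 * l + 1)).
  rewrite opprD expRD mE.
  have e1 := expRxMexpNx_1 (1 : R).
  have h1 : mu * (P * (Q * nu)) <=
      k * expR (- 1) * (expR 1 * e * (C * X) * P * Q * X * l * expR (- (eps * y))).
    have -> : k * expR (- 1) * (expR 1 * e * (C * X) * P * Q * X * l * expR (- (eps * y)))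
      = expR 1 * expR (- 1) * (e * (C * X) * (k * l) * (P * (Q * nu))) by rewrite nuE; ring.
    rewrite e1 mul1r ler_wpM2r ?mulr_ge0 // muE ler_wpM2r ?mulr_ge0 ?(ltW k0) ?(ltW l0) //.
    rewrite -mulrA ler_wpM2l // ler_wpM2l //.
    by rewrite -[leRHS]mul1r ler_wpM2r.
  apply: le_trans h1 _.
  apply: le_trans (ler_wpM2l _ By) _; first by rewrite mulr_ge0 ?expR_ge0 // ltW.
  have D1 : 1 <= D%:R :> R by rewrite ler1n.
  rewrite mulrAC -mulrA -[leRHS]mulrA ler_peMl //.
  by rewrite !mulr_ge0 ?expR_ge0 // ltW.
apply: le_trans (exprn_fact_decay _ step1) _; first by rewrite !mulr_ge0.
rewrite -expRD ler_expR mE.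
have kl0 : 0 <= k * l by rewrite mulr_ge0 // ltW.
have := ler_wpM2r kl0 hD; lra.
Qed.

Lemma few_edges_le (p d C l k delta : R) (N t : nat) : 0 <= p -> p <= 1 -> 0 < delta ->
  l <= k * l -> C * l * k / 4 <= N%:R * p -> 16 * (d + 1) <= C * delta ^+ 2 ->
  0 <= k * l -> t%:R <= (1 - delta) * N%:R * p ->
  (1 - p * (1 - expR (- (delta / 2)))) ^+ N / expR (- (delta / 2)) ^+ t
    <= expR (- (d * l * k)) * expR (- l).
Proof.
move=> p0 p1 delta0 kl Np_ge hC kl0 ht.
apply: le_trans (chernoff_le p0 p1 delta0 ht) _; rewrite -expRD ler_expR.
have d2 : 0 <= delta ^+ 2 / 4 by rewrite divr_ge0 ?exprn_ge0 // ltW.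
have := ler_wpM2l d2 Np_ge; have := ler_wpM2r kl0 hC.
move: (delta ^+ 2) => z; lra.
Qed.

(** Each petal costs a power of [k], so constantly many petals beat the number of kernels, of order
    [n ^ v]. *)
Lemma kernel_sunflowers_le (nu d eps C l e X P y Q v : R) (L : nat) :
  0 <= nu -> 0 <= Q -> 1 <= P -> 1 <= X -> 1 <= e -> 1 <= C -> 1 <= l ->
  2 * (d * v + 1) <= eps * L%:R -> nu = X * expR (- (eps * y)) ->
  expR 1 * e * (C * X) * P * Q * X * l * expR (- (eps * y)) <= expR (- (eps / 2 * l)) ->
  (Q * nu) ^+ L <= expR (- (d * l * v)) * expR (- l).
Proof.
move=> nu0 Q0 P1 X1 e1 C1 l1 hL nuE By.
have step1 : Q * nu <= expR (- (eps / 2 * l)).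
  apply: le_trans By.
  have -> : expR 1 * e * (C * X) * P * Q * X * l * expR (- (eps * y)) =
    (expR 1 * (e * (C * X * (P * l)))) * (Q * nu) by rewrite nuE; ring.
  rewrite ler_peMl ?mulr_ge0 // mulr_ege1 //; first by rewrite -expR0 ler_expR.
  by rewrite !mulr_ege1.
apply: le_trans (_ : expR (- (eps / 2 * l)) ^+ L <= _).
  by rewrite lerXn2r ?nnegrE ?expR_ge0 ?mulr_ge0.
rewrite -expRM_natr -expRD ler_expR.
have l0 : 0 <= l by lra.
have := ler_wpM2l l0 hL; lra.
Qed.

(** Here [A] is merely bounded and the decay comes from [r!]: with [r] of order [l], large [l] makes
    [Q * A] tiny compared to [r], which beats the [n ^ 2] possible edges. *)
Lemma edge_sunflowers_le (A Q X M2 d eta l : R) (r : nat) :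
  0 <= A -> 0 <= Q -> A <= X -> 0 < eta -> 0 < d -> 0 < l ->
  Q * X * expR (M2 + 1) <= eta * l / 2 -> eta * l / 2 <= r%:R ->
  2 * (2 * d + 1) <= eta * M2 ->
  (Q * A) ^+ r / r`!%:R <= expR (- (d * l * 2)) * expR (- l).
Proof.
move=> A0 Q0 AX eta0 d0 l0 lr rge hM.
have step1 : Q * A <= r%:R * expR (- (M2 + 1)).
  rewrite expRN ler_pdivlMr ?expR_gt0 //; apply: le_trans rge; apply: le_trans lr.
  by rewrite ler_wpM2r ?expR_ge0 // ler_wpM2l.
apply: le_trans (exprn_fact_decay _ step1) _; first by rewrite mulr_ge0.
rewrite -expRD ler_expR.
have M20 : 0 <= M2.
  by rewrite -(pmulr_rge0 _ eta0) (le_trans _ hM) // mulr_ge0 //; lra.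
have h1 := ler_wpM2l M20 rge.
have h2 := ler_wpM2r (ltW l0) hM.
lra.
Qed.

End RealBounds.

(* [l = log k] and [y = log (k / log k)], so that [n <= c * expR (d * y)] and
   [p = C * expR (- y)]. *)
Lemma gnp_fixed_size (R : realType) (T : finType) (H : graph T)
    (Hbal : strictly_2balanced R H) (Hd : 1 < m2 R H)
    (eps delta C c eta M2 d M : R) (v e Q kappa D L k n : nat) (l y p : R)
    (vE : #|vset H| = v) (eE : #|eset H| = e) (dE : m2 R H = d)
    (QE : Q = (2 ^ e * v ^ v + 4 * (e * v))%N)
    (ME : M = (d + 1) * 16 * e%:R / delta)
    (kappaE : kappa = (2 * e * D * (1 + e) * (e * (L * e) ^ e * e))%N)
    (eps0 : 0 < eps) (eps_d : 2 * eps <= d - 1)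
    (eps_gap : forall S : {set {set _}}, S \proper abstract_edges H -> (2 <= #|S|)%N ->
       eps <= d * (#|cover S|%:R - 2) - (#|S|%:R - 1))
    (delta0 : 0 < delta) (delta1 : delta < 1)
    (C1 : 1 <= C) (C_large : 16 * (d + 1) <= C * delta ^+ 2)
    (c0 : 0 < c) (c1 : c <= 1)
    (c_small : c * (16 * e%:R ^+ 2 * C ^+ e) <= delta * expR (- (M + 1)))
    (D_large : 2 * (d + 1) <= eps * D%:R)
    (L_large : 2 * (d * v%:R + 1) <= eps * L%:R)
    (eta0 : 0 < eta) (eta_small : 8 * kappa%:R * eta <= delta)
    (M2_large : 2 * (2 * d + 1) <= eta * M2)
    (k2 : (2 <= k)%N) (kE : k%:R = expR l) (l1 : 1 <= l) (yE : y = l - ln l)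
    (y0 : 0 <= y) (Cy : C <= expR y) (ly : l <= expR (eps * y))
    (By : expR 1 * e%:R * C ^+ e.+1 * 2 ^+ e * Q%:R * C ^+ e * l * expR (- (eps * y))
          <= expR (- (eps / 2 * l)))
    (ls : 8 * e%:R <= delta * l) (leta : 1 <= eta * l)
    (lr : Q%:R * C ^+ e * expR (M2 + 1) <= eta * l / 2)
    (hn : n%:R <= c * expR (d * y)) (pE : p = C * l / k%:R) :
  1 - (2 ^+ e + 4) * expR (- l) <=
  gnp_prob p (fun G : graph 'I_n => forall K : {set 'I_n}, #|K| = k ->
     (Y_ H G K)%:R <= delta * 'C(k, 2)%:R * p /\
     (1 - delta) * 'C(k, 2)%:R * p <= (X_ G K)%:R) <= 1.
Proof.
have [v3 e2] := m2E Hbal Hd; rewrite vE eE dE => dve.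
have d1 : 1 < d by rewrite -dE.
clear Hbal; rewrite vE in v3; rewrite eE in e2.
have d0 : 0 < d := lt_trans ltr01 d1.
have l0 : 0 < l := lt_le_trans ltr01 l1.
have C0 : 0 < C := lt_le_trans ltr01 C1.
have k0 : 0 < k%:R :> R by rewrite kE expR_gt0.
have e1r : 2 <= e%:R :> R by rewrite ler_nat.
have e0 : 0 < e%:R :> R by apply: lt_le_trans e1r.
have Ce1 : 1 <= C ^+ e by rewrite exprn_ege1.
have pyE : p = C * expR (- y).
  by rewrite pE yE opprB expRB lnK ?posrE // -kE mulrA.
have p0 : 0 <= p by rewrite pyE mulr_ge0 ?expR_ge0 // ltW.
have p1 : p <= 1 by rewrite pyE expRN ler_pdivrMr ?expR_gt0 // mul1r.
have yl : y <= l by rewrite yE gerBl ln_ge0.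
have Q1 : 1 <= Q%:R :> R.
  by rewrite ler1n QE addn_gt0 muln_gt0 !expn_gt0 /= (leq_trans _ v3).
have Q0 : 0 <= Q%:R :> R by [].
(* In [A] all powers of [expR y] cancel because [d * (v - 2) = e - 1]; for kernels with more edges
   the gap [eps] survives, whence [nu]. *)
pose A : R := c * C ^+ e.
pose nu : R := C ^+ e * expR (- (eps * y)).
have X0 : 0 <= C ^+ e := le_trans ler01 Ce1.
have nu0 : 0 <= nu by rewrite mulr_ge0 ?expR_ge0.
have A0 : 0 <= A by rewrite mulr_ge0 // ltW.
have A_le : A <= C ^+ e by rewrite -[leRHS]mul1r ler_wpM2r.
have cexp a : c ^+ a <= 1 by rewrite exprn_ile1 // ltW.
have Cexp a : (a <= e)%N -> C ^+ a <= C ^+ e by move=> ae; rewrite ler_weXn2l.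
have ccC a b w : (b <= e)%N -> c ^+ a * C ^+ b * expR w <= C ^+ e * expR w.
  by move=> be; rewrite ler_wpM2r ?expR_ge0 // -[leRHS]mul1r ler_pM ?exprn_ge0 ?Cexp
    ?(ltW c0) ?(ltW C0) //.
have hnu (S : {set {set _}}) : S \proper abstract_edges H -> (2 <= #|S|)%N ->
     (n ^ (v - #|cover S|))%:R * p ^+ (e - #|S|) <= nu.
  move=> pS S2; apply: le_trans (powers_le _ _ (ltW c0) (ltW C0) hn pyE) _.
  apply: le_trans (ccC _ _ _ (leq_subr _ _)) _.
  rewrite ler_wpM2l // ler_expR.
    have Se : (#|S| <= e)%N by rewrite -eE -card_abstract_edges subset_leq_card //
      proper_sub.
    have Sv : (#|cover S| <= v)%N.
      by apply: leq_trans (max_card _) _; rewrite card_sig -vE; apply/eq_leq/eq_card.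
    rewrite natrB // natrB //; have := eps_gap S pS S2; move=> gap.
    rewrite -mulNr ler_wpM2r //; nra.
have hA : (n ^ (v - 2))%:R * p ^+ (e - 1) <= A.
  apply: le_trans (powers_le _ _ (ltW c0) (ltW C0) hn pyE) _.
  rewrite natrB 1?ltnW // natrB 1?ltnW // dve subrr mul0r expR0 mulr1 ler_pM ?exprn_ge0
    ?(ltW c0) ?(ltW C0) //.
    by rewrite -[leRHS]expr1 ler_wiXn2l ?subn_gt0 // ltW.
  by rewrite Cexp // leq_subr.
have hnu1 : k%:R * (n ^ (v - 3))%:R * p ^+ (e - 1) <= nu.
  rewrite -mulrA.
  apply: le_trans (ler_wpM2l (ltW k0) (powers_le _ _ (ltW c0) (ltW C0) hn pyE)) _.
  apply: le_trans (ler_wpM2l (ltW k0) (ccC _ _ _ (leq_subr _ _))) _.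
  rewrite mulrCA ler_wpM2l //.
  (* The exponent of [expR y] is now [1 + d * (v - 3) - (e - 1) = 1 - d], at most [- 2 * eps]; one
     [eps] pays for the factor [l]. *)
  have -> : k%:R = l * expR y by rewrite yE expRB lnK ?posrE // -kE mulrC divfK // gt_eqF.
  rewrite -mulrA -expRD.
  apply: le_trans (ler_wpM2r (expR_ge0 _) ly) _.
  rewrite -expRD ler_expR natrB // natrB 1?ltnW //.
  have : 0 <= (d - 1 - 2 * eps) * y by rewrite mulr_ge0 // subr_ge0.
  nra.
(* [s * e] takes half of the allowed number of covered edges. Rounding down in [t] is right since
   the good event has more than [t] edges in [K]. *)
pose s := Num.trunc (delta * C * k%:R * l / (8 * e%:R)).
pose m := (D * k)%N.
pose r := Num.trunc (eta * l).
pose N := 'C(k, 2).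
pose t := Num.trunc ((1 - delta) * N%:R * p).
pose z := expR (- (delta / 2)).
pose b := (s * e + (m * (2 * e) + m * (2 * e) * e) * (r * e * (L * e) ^ e * e))%N.
pose mu := e%:R * k%:R ^+ 2 * p * A.
have kr2 : 2 <= k%:R :> R by rewrite ler_nat.
have /andP[r_ge r_le] := truncn_half leta.
have /andP[s_ge s_le] : delta * C * k%:R * l / (8 * e%:R) / 2 <= s%:R <= delta * C * k%:R
  * l / (8 * e%:R).
  apply: truncn_half; rewrite ler_pdivlMr ?mul1r ?mulr_gt0 //.
  apply: le_trans ls _; have -> : delta * C * k%:R * l = delta * l * (C * k%:R) by ring.
  apply: ler_peMr; first by rewrite mulr_ge0 // ltW.
  by rewrite mulr_ege1 // (le_trans _ kr2) // ler1n.
have NE : N%:R = k%:R * (k%:R - 1) / 2 :> R by rewrite /N natr_bin2 // ltnW.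
have NpE : N%:R * p = C * l * (k%:R - 1) / 2 by rewrite NE pE; field; rewrite gt_eqF.
have lk0 : 0 <= C * l by rewrite mulr_ge0 // ltW.
have Np_ge : C * l * k%:R / 4 <= N%:R * p.
  by rewrite NpE half_pairs_ge.
have Np0 : 0 <= N%:R * p by rewrite mulr_ge0.
have hb : b%:R <= delta * N%:R * p.
  have -> : b = (s * e + kappa * k * r)%N by rewrite /b /m kappaE; ring.
  rewrite natrD !natrM -[leRHS]mulrA.
  by apply: (budget_le (l := l) (C := C) (eta := eta)).
have t0 : 0 <= (1 - delta) * N%:R * p by rewrite -mulrA mulr_ge0 // subr_ge0 ltW.
have /andP[t1 t2] := truncn_itv t0.
have z0 : 0 < z := expR_gt0 _.
have z1 : z <= 1 by rewrite -expR0 ler_expR oppr_le0 divr_ge0 // ltW.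
have L0 : (0 < L)%N.
  rewrite lt0n; apply: contraTneq L_large => ->; rewrite mulr0 -ltNge mulr_gt0 //.
  by rewrite ltr_wpDl // mulr_ge0 // ltW.
have v0 : (0 < v)%N by rewrite (leq_trans _ v3).
set prob := gnp_prob p _.
have /andP[lo ->] :
    1 - ((n ^ k)%:R * (mu ^+ s / s`!%:R + (mu * (2 ^+ e * (Q%:R * nu))) ^+ m / m`!%:R
                  + (1 - p * (1 - z)) ^+ N / z ^+ t)
       + (n ^ v * 2 ^ e)%:R * (Q%:R * nu) ^+ L + (n ^ 2)%:R * ((Q%:R * A) ^+ r / r`!%:R))
    <= prob <= 1.
  subst v e.
  exact: (gnp_event_bounds e2 v0 p0 p1 z0 z1 L0 nu0 A0 hnu hA hnu1
    (leqnn b) hb (ltW t2) (congr1 (fun i => i%:R) QE) (erefl mu)).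
rewrite andbT; apply: le_trans lo; rewrite lerD2l lerN2.
have npow a : (n ^ a)%:R <= expR (d * l * a%:R).
  rewrite natrX expRM_natr lerXn2r ?nnegrE ?expR_ge0 //.
  apply: le_trans hn _; apply: le_trans (_ : 1 * expR (d * y) <= _).
    by rewrite ler_wpM2r ?expR_ge0.
  by rewrite mul1r ler_expR ler_wpM2l // ltW.
have muE : mu = e%:R * C * (c * C ^+ e) * (k%:R * l).
  by rewrite /mu /A pE; move: (C ^+ e) => X; field; rewrite gt_eqF.
have mu0 : 0 <= mu by rewrite mulr_ge0 // mulr_ge0 // mulr_ge0 // exprn_ge0 // ltW.
have kl : l <= k%:R * l by rewrite ler_peMl ?ler1n ?(ltnW k2) // ltW.
have [cn en ln'] : [/\ 0 <= c, 0 <= e%:R :> R & 0 <= k%:R * l] by rewrite mulr_ge0 ?ltW.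
have P1 : 1 <= 2 ^+ e :> R by rewrite exprn_ege1 // ler1n.
have [P0 e1] : 0 <= 2 ^+ e :> R /\ 1 <= e%:R :> R by rewrite exprn_ge0 // ler1n ltnW.
have T1 : mu ^+ s / s`!%:R <= expR (- (d * l * k%:R)) * expR (- l).
  by apply: (many_copies_le (M := M) (delta := delta) (C := C) (c := c) (X := C ^+ e) (e
    := e%:R)) => //.
have T2 : (mu * (2 ^+ e * (Q%:R * nu))) ^+ m / m`!%:R <= expR (- (d * l * k%:R)) * expR
  (- l).
  apply: (many_clusters_le (eps := eps) (C := C) (c := c) (X := C ^+ e) (e := e%:R) (y :=
    y) (D := D)) => //.
  - by rewrite /m natrM.
  - by rewrite lt0n; apply/eqP => D0; move: D_large; rewrite D0 mulr0 leNgt mulr_gt0 //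
    addr_gt0.
  - by rewrite -exprS.
have T3 : (1 - p * (1 - z)) ^+ 'C(k, 2) / z ^+ t <= expR (- (d * l * k%:R)) * expR (- l).
  by apply: (few_edges_le (C := C)) => //.
have T4 : (Q%:R * nu) ^+ L <= expR (- (d * l * v%:R)) * expR (- l).
  apply: (kernel_sunflowers_le (eps := eps) (C := C) (X := C ^+ e) (e := e%:R) (P := 2 ^+
    e) (y := y)) => //.
  by rewrite -exprS.
have T5 : (Q%:R * A) ^+ r / r`!%:R <= expR (- (d * l * 2%:R)) * expR (- l).
  by apply: (edge_sunflowers_le (X := C ^+ e) (M2 := M2) (eta := eta)) => //.
(* Every union bound has at most [n ^ a] cases up to a constant; after it each error term is
   [expR (- l)] up to a constant. *)
have npow1 a x : x <= expR (- (d * l * a%:R)) * expR (- l) -> (n ^ a)%:R * x <= expR (- l).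
  move=> hx; apply: le_trans (ler_wpM2l _ hx) _ => //.
  rewrite mulrA -[leRHS]mul1r ler_wpM2r ?expR_ge0 //.
  apply: le_trans (ler_wpM2r (expR_ge0 _) (npow a)) _.
  by rewrite expRxMexpNx_1.
rewrite mulrDr mulrDr (natrM _ (n ^ v)) (natrX _ 2 e).
have E1 := npow1 _ _ T1; have E2 := npow1 _ _ T2; have E3 := npow1 _ _ T3.
have E5 := npow1 _ _ T5.
have E4 : (n ^ v)%:R * 2 ^+ e * (Q%:R * nu) ^+ L <= 2 ^+ e * expR (- l).
  by rewrite mulrAC mulrC ler_wpM2l ?exprn_ge0 // npow1.
apply: le_trans (lerD (lerD (lerD (lerD E1 E2) E3) E4) E5) _.
by rewrite mulrDl; clear; move: (expR (- l)) (2 ^+ e * _) => x w; lra.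
Qed.

(** * Asymptotics *)

Local Open Scope classical_set_scope.
Local Open Scope ring_scope.

(** With [r] the square root of [l], [ln l = 2 * ln r <= 2 * r <= kap * r ^+ 2]. *)
Lemma ln_small (R : realType) (kap l : R) : 0 < kap -> 4 / kap ^+ 2 <= l -> ln l <= kap * l.
Proof.
move=> kap0 hl; have k2 : 0 < kap ^+ 2 by rewrite exprn_gt0.
have l0 : 0 < l by apply: lt_le_trans hl; rewrite divr_gt0.
set r := Num.sqrt l; have r0 : 0 < r by rewrite sqrtr_gt0.
have lr : l = r ^+ 2 by rewrite sqr_sqrtr // ltW.
have h : 2 <= kap * r.
  rewrite -(ler_pXn2r (n := 2)) ?nnegrE ?mulr_ge0 ?(ltW kap0) ?(ltW r0) // exprMn -lr.
  have -> : 2 ^+ 2 = 4 :> R by ring.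
  by rewrite [leRHS]mulrC -ler_pdivrMr.
have h1 := ln_sublinear r0.
have h2 : 0 <= (kap * r - 2) * r by rewrite mulr_ge0 ?(ltW r0) // subr_ge0.
rewrite lr lnXn // mulr2n; rewrite expr2; lra.
Qed.

Lemma large_l (R : realType) (eps C B delta eta K W : R) :
  0 < eps -> 0 <= C -> 0 <= B -> 0 < delta -> 0 < eta -> 0 <= K -> 0 <= W ->
  exists l0 : R, forall l y, l0 <= l -> y = l - ln l ->
    [/\ 1 <= l, 0 <= y, C <= expR y & l <= expR (eps * y)] /\
    [/\ B * l * expR (- (eps * y)) <= expR (- (eps / 2 * l)),
        K <= delta * l, 1 <= eta * l & W <= eta * l / 2].
Proof.
move=> eps0 C0 B0 delta0 eta0 K0 W0.
(* Chosen so that [(1 + eps) * ln l] is at most [eps * l / 4]; the constant [B] may use another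
   [eps * l / 4]. *)
pose kap := eps / (4 * (1 + eps)).
have kap0 : 0 < kap by rewrite divr_gt0 //; lra.
have kapE : kap * (1 + eps) = eps / 4 by rewrite /kap; field; lra.
have kap4 : kap <= 1 / 4 by rewrite /kap ler_pdivrMr; lra.
pose a1 := 4 / kap ^+ 2; pose a2 := 4 * B / eps; pose a3 := 2 * C.
pose a4 := K / delta; pose a5 := eta^-1; pose a6 := 2 * W / eta.
have a10 : 0 <= a1 by rewrite divr_ge0 ?exprn_ge0 // ltW.
have a20 : 0 <= a2 by rewrite divr_ge0 ?mulr_ge0 // ltW.
have a30 : 0 <= a3 by rewrite mulr_ge0.
have a40 : 0 <= a4 by rewrite divr_ge0 // ltW.
have a50 : 0 <= a5 by rewrite invr_ge0 ltW.
have a60 : 0 <= a6 by rewrite divr_ge0 ?mulr_ge0 // ltW.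
(* The sum of nonnegative thresholds exceeds each of them. *)
exists (1 + a1 + a2 + a3 + a4 + a5 + a6) => l y hl yE.
have l1 : 1 <= l by lra.
have l0 : 0 < l by lra.
have hln : ln l <= kap * l by apply: ln_small => //; rewrite -/a1; lra.
have h2 : 4 * B <= eps * l by rewrite [leRHS]mulrC -ler_pdivrMr // -/a2; lra.
have h3 : 2 * C <= l by have : a3 <= l by lra.
have h4 : K <= delta * l by rewrite [leRHS]mulrC -ler_pdivrMr // -/a4; lra.
have h5 : 1 <= eta * l by rewrite [leRHS]mulrC -ler_pdivrMr // mul1r -/a5; lra.
have h6 : 2 * W <= eta * l by rewrite [leRHS]mulrC -ler_pdivrMr // -/a6; lra.
have h7 : kap * l <= l / 4 by have := ler_wpM2r (ltW l0) kap4; lra.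
have h8 : (1 + eps) * ln l <= eps / 4 * l.
  have -> : eps / 4 * l = (1 + eps) * (kap * l) by rewrite -kapE; ring.
  rewrite ler_wpM2l //; lra.
have le_exp (x : R) : x <= expR x by have := expR_ge1Dx x; lra.
have epsl : 0 < eps * l by rewrite mulr_gt0.
split; split => //; try lra.
- by apply: le_trans (le_exp y); lra.
- by rewrite -[leLHS]lnK ?posrE // ler_expR yE; lra.
- apply: le_trans (_ : expR B * expR (ln l) * expR (- (eps * y)) <= _).
    by rewrite lnK ?posrE // !ler_wpM2r ?expR_ge0 // ltW.
  rewrite -!expRD ler_expR yE; lra.
Qed.

Lemma near_ln (R : realType) (l0 : R) :
  \forall k \near \oo, l0 <= ln (k%:R : R) /\ (2 <= k)%N.
Proof.
near=> k; split; last by near: k; exact: nbhs_infty_ge.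
have : expR l0 <= k%:R :> R by near: k; exact: nbhs_infty_ger.
by move=> h; rewrite -[leLHS]expRK ler_ln ?posrE ?expR_gt0 // (lt_le_trans (expR_gt0 _) h).
Unshelve. all: by end_near. Qed.

Lemma floor_vertices_le (R : realType) (c d l : R) (k : nat) : 0 < c -> 0 < l ->
  k%:R = expR l ->
  `|Num.floor (c * ((k%:R / l) `^ d))|%N%:R <= c * expR (d * (l - ln l)).
Proof.
move=> c0 l0 kE; have x0 : 0 < k%:R / l by rewrite kE divr_gt0 ?expR_gt0.
have -> : expR (d * (l - ln l)) = (k%:R / l) `^ d.
  by rewrite /powR gt_eqF // ln_div ?posrE // ?kE ?expR_gt0 // expRK.
rewrite natr_absz ger0_norm ?floor_ge0 ?mulr_ge0 ?powR_ge0 ?(ltW c0) //.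
exact: floor_le.
Qed.

Lemma gnp_prob_no_large_set (R : realType) (n k : nat) (p : R)
    (A : graph 'I_n -> {set 'I_n} -> Prop) :
  0 <= p -> p <= 1 -> (n < k)%N ->
  gnp_prob p (fun G => forall K : {set 'I_n}, #|K| = k -> A G K) = 1.
Proof.
move=> p0 p1 nk.
have : 1 - Pr (@edge_prob 'I_n R p) xpred0 <=
    gnp_prob p (fun G => forall K : {set 'I_n}, #|K| = k -> A G K) <= 1.
  apply: (gnp_prob_bounds p0 p1) => G _ _ K Kk.
  by move: nk; rewrite -Kk ltnNge -[X in (_ <= X)%N]card_ord max_card.
by rewrite /Pr big_pred0 // subr0 => /andP[? ?]; apply/eqP; rewrite eq_le; apply/andP.
Qed.

(** There are finitely many [S], so the strict inequalities of [m2_gt_sub] have a common gap; the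
    default value of the minimum enforces the second bound. *)
Lemma exists_gap (R : realType) (T : finType) (H : graph T) :
  strictly_2balanced R H -> 1 < m2 R H ->
  exists eps : R, [/\ 0 < eps, 2 * eps <= m2 R H - 1 &
    forall S : {set {set _}}, S \proper abstract_edges H -> (2 <= #|S|)%N ->
      eps <= m2 R H * (#|cover S|%:R - 2) - (#|S|%:R - 1)].
Proof.
move=> Hbal Hd.
pose P (S : {set {set {x : T | x \in vset H}}}) :=
  (S \proper abstract_edges H) && (2 <= #|S|)%N.
pose f (S : {set {set {x : T | x \in vset H}}}) : R :=
  m2 R H * (#|cover S|%:R - 2) - (#|S|%:R - 1).
exists (\big[Num.min/((m2 R H - 1) / 2)]_(S | P S) f S); split.
- apply: lt_bigmin; first by rewrite divr_gt0 // subr_gt0.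
  by move=> S /andP[pS S2]; rewrite subr_gt0; apply: m2_gt_sub.
- rewrite mulrC -ler_pdivlMr //; exact: bigmin_le_id.
- by move=> S pS S2; apply: (bigmin_le_cond _ (P := P) f); rewrite /P pS S2.
Qed.

(** * Choice of the constants and passage to the limit *)

Theorem theorem1 (R : realType) (T : finType) (H : graph T) :
  strictly_2balanced R H ->
  forall delta : R, 0 < delta ->
  exists C0 : R, 0 < C0 /\
  forall C : R, C0 <= C ->
  exists c0 : R, 0 < c0 /\
  forall c : R, 0 < c -> c <= c0 ->
  (fun k : nat =>
     let n := `|Num.floor (c * ((k%:R / ln k%:R) `^ m2 R H))|%N in
     let p : R := C * ln k%:R / k%:R in
     gnp_prob p (fun G : graph 'I_n =>
       forall K : {set 'I_n}, #|K| = k ->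
         (Y_ H G K)%:R <= delta * 'C(k, 2)%:R * p /\
         (1 - delta) * 'C(k, 2)%:R * p <= (X_ G K)%:R))
  @ \oo --> (1 : R).
Proof.
move=> Hbal delta delta0.
have [d1|d1] := leP (m2 R H) 1.
  exists 1; split=> // C C1; exists 1; split=> // c c0 c1.
  have C0 : 0 <= C := le_trans ler01 C1.
  have [l0 large] := large_l (@ltr01 R) C0 (lexx 0) ltr01 ltr01 (lexx 0) (lexx 0).
  apply/cvgrPdist_le => eps eps0; near=> k.
  have [lk k2] : Num.max l0 2 <= ln (k%:R : R) /\ (2 <= k)%N.
    by near: k; exact: near_ln.
  move: lk; rewrite ge_max => /andP[lk l2].
  have [[l1 y0 Cy _] _] := large _ _ lk (erefl _).
  set l := ln k%:R in lk l2 l1 y0 Cy *.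
  have k0 : 0 < k%:R :> R by rewrite ltr0n (leq_trans _ k2).
  have kE : k%:R = expR l by rewrite lnK ?posrE.
  have lpos : 0 < l := lt_le_trans ltr01 l1.
  rewrite /= gnp_prob_no_large_set ?subrr ?normr0 ?(ltW eps0) //.
  - by rewrite divr_ge0 ?mulr_ge0 // ltW.
  - rewrite ler_pdivrMr // mul1r kE; move: Cy; rewrite expRB lnK ?posrE //.
    by rewrite ler_pdivlMr.
  (* As [c] and [m2 R H] are at most 1, [n] is at most [k / l], hence below [k]. *)
  - rewrite -(ltr_nat R).
    apply: le_lt_trans (floor_vertices_le _ c0 lpos kE) _.
    apply: le_lt_trans (_ : 1 * expR (l - ln l) < _).
      by rewrite ler_pM ?expR_ge0 ?(ltW c0) // ler_expR -[leRHS]mul1r ler_wpM2r.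
    rewrite mul1r kE ltr_expR ltrBlDr ltrDl ln_gt0 //.
    by apply: lt_le_trans l2; rewrite ltr1n.
have [eps [eps0 eps_d eps_gap]] := exists_gap Hbal d1.
(* The estimates require a value below 1; the claim for a smaller value implies the one for
   [delta]. *)
pose del : R := Num.min delta (1 / 2).
have del0 : 0 < del by rewrite lt_min delta0 divr_gt0.
have del1 : del < 1 by rewrite gt_min; apply/orP; right; lra.
have deld : del <= delta by rewrite ge_min lexx.
pose d := m2 R H; pose v := #|vset H|; pose e := #|eset H|.
have [v3 e2 _] := m2E Hbal d1.
pose Q := (2 ^ e * v ^ v + 4 * (e * v))%N.
(* The order of choice avoids circularity: [D] and [L] depend on [eps], then [kappa] on these, [eta]
   on [kappa], [M2] on [eta], and none of them on [C] or [c]. *)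
pose D := (Num.trunc (2 * (d + 1) / eps)).+1.
pose L := (Num.trunc (2 * (d * v%:R + 1) / eps)).+1.
pose kappa := (2 * e * D * (1 + e) * (e * (L * e) ^ e * e))%N.
pose eta : R := del / (8 * (kappa%:R + 1)).
pose M2 := 2 * (2 * d + 1) / eta.
pose M := (d + 1) * 16 * e%:R / del.
have d0 : 0 < d by apply: lt_trans d1.
have e0 : 0 < e%:R :> R by rewrite ltr0n (leq_trans _ e2).
have D_large : 2 * (d + 1) <= eps * D%:R.
  rewrite [leRHS]mulrC -ler_pdivrMr // ltW //.
  have h : 0 <= 2 * (d + 1) / eps by rewrite divr_ge0 ?(ltW eps0) // mulr_ge0 // addr_ge0
    // ltW.
  by have /andP[] := truncn_itv h.
have L_large : 2 * (d * v%:R + 1) <= eps * L%:R.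
  rewrite [leRHS]mulrC -ler_pdivrMr // ltW //.
  have h : 0 <= 2 * (d * v%:R + 1) / eps.
    by rewrite divr_ge0 ?(ltW eps0) // mulr_ge0 // addr_ge0 // mulr_ge0 // ltW.
  by have /andP[] := truncn_itv h.
have kap0 : 0 < 8 * (kappa%:R + 1) :> R by rewrite mulr_gt0 // ltr_wpDl.
have eta0 : 0 < eta by rewrite divr_gt0.
have eta_small : 8 * kappa%:R * eta <= del.
  rewrite /eta mulrA ler_pdivrMr // mulrC ler_wpM2l ?(ltW del0) //.
  by rewrite ler_wpM2l // lerDl.
have M2_large : 2 * (2 * d + 1) <= eta * M2 by rewrite /M2 [leRHS]mulrC divfK ?gt_eqF.
(* The first summand makes the Chernoff bound beat [n ^ k], the second ensures [1 <= C]. *)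
exists (16 * (d + 1) / del ^+ 2 + 1); split.
  by rewrite ltr_wpDl // divr_ge0 ?exprn_ge0 ?(ltW del0) // mulr_ge0 // addr_ge0 // ltW.
move=> C hC.
have hd2 : 0 <= 16 * (d + 1) / del ^+ 2.
  by rewrite divr_ge0 ?exprn_ge0 ?(ltW del0) // mulr_ge0 // addr_ge0 // ltW.
have C1 : 1 <= C by apply: le_trans hC; rewrite lerDr.
have C0 : 0 <= C := le_trans ler01 C1.
have C_large : 16 * (d + 1) <= C * del ^+ 2.
  rewrite -ler_pdivrMr ?exprn_gt0 //; apply: le_trans hC; rewrite lerDl //.
pose w := 16 * e%:R ^+ 2 * C ^+ e.
have w0 : 0 < w.
  by rewrite !mulr_gt0 ?exprn_gt0 // (lt_le_trans ltr01).
(* The second bound is the condition on [c] in [many_copies_le]. *)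
exists (Num.min 1 (del * expR (- (M + 1)) / w)); split.
  by rewrite lt_min ltr01 divr_gt0 // mulr_gt0 ?expR_gt0.
move=> c c0; rewrite le_min => /andP[c1]; rewrite ler_pdivlMr // => c_small.
pose B := expR 1 * e%:R * C ^+ e.+1 * 2 ^+ e * Q%:R * C ^+ e.
have B0 : 0 <= B.
  by rewrite !mulr_ge0 ?expR_ge0 ?exprn_ge0.
have [l0 large] := large_l (K := 8 * e%:R) (W := Q%:R * C ^+ e * expR (M2 + 1)) eps0 C0
  B0 del0 eta0
   (mulr_ge0 (ler0n _ _) (ler0n _ _)) (mulr_ge0 (mulr_ge0 (ler0n _ _) (exprn_ge0 _ C0))
     (expR_ge0 _)).
apply/cvgrPdist_le => tau tau0; near=> k.
(* With [expR (- l) <= l^-1], this lower bound on [l] brings the total error below [tau]. *)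
have [lk k2] : Num.max l0 ((2 ^+ e + 4) / tau) <= ln (k%:R : R) /\ (2 <= k)%N.
  by near: k; exact: near_ln.
move: lk; rewrite ge_max => /andP[lk ltau].
have [[l1 y0 Cy ly] [By ls leta lr]] := large _ _ lk (erefl _).
set l := ln k%:R in lk ltau l1 y0 Cy ly By ls leta lr *.
have k0 : 0 < k%:R :> R by rewrite ltr0n (leq_trans _ k2).
have kE : k%:R = expR l by rewrite lnK ?posrE.
have lpos : 0 < l := lt_le_trans ltr01 l1.
rewrite /=; set n := absz _; set p := C * l / k%:R.
have hn : n%:R <= c * expR (d * (l - ln l)) := floor_vertices_le _ c0 lpos kE.
have p0 : 0 <= p by rewrite divr_ge0 ?mulr_ge0 // ltW.
have p1 : p <= 1.
  rewrite /p ler_pdivrMr // mul1r kE; move: Cy; rewrite expRB lnK ?posrE //.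
  by rewrite ler_pdivlMr.
have /andP[lo _] := gnp_fixed_size Hbal d1 (erefl v) (erefl e) (erefl d) (erefl Q)
  (erefl M) (erefl kappa) eps0 eps_d eps_gap del0 del1 C1 C_large c0 c1 c_small
  D_large L_large eta0 eta_small M2_large k2 kE l1 (erefl (l - ln l)) y0 Cy ly By ls leta lr
  hn (erefl p).
have mono : forall G : graph 'I_n, (forall K : {set 'I_n}, #|K| = k ->
     (Y_ H G K)%:R <= del * 'C(k, 2)%:R * p /\
     (1 - del) * 'C(k, 2)%:R * p <= (X_ G K)%:R) ->
   forall K : {set 'I_n}, #|K| = k ->
     (Y_ H G K)%:R <= delta * 'C(k, 2)%:R * p /\
     (1 - delta) * 'C(k, 2)%:R * p <= (X_ G K)%:R.
  move=> G hG K Kk; have [hY hX] := hG K Kk.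
  have N0 : 0 <= 'C(k, 2)%:R * p by rewrite mulr_ge0.
  split; [apply: le_trans hY _|apply: le_trans _ hX]; rewrite -!mulrA ler_wpM2r //.
  by rewrite lerD2l lerN2.
have lo2 := le_trans lo (gnp_prob_le p0 p1 mono).
(* Comparison with the sure event shows that the probability is at most 1. *)
have hi2 := gnp_prob_le p0 p1 (fun G (_ : forall K : {set 'I_n}, #|K| = k ->
     (Y_ H G K)%:R <= delta * 'C(k, 2)%:R * p /\
     (1 - delta) * 'C(k, 2)%:R * p <= (X_ G K)%:R) => I).
have /andP[_ one] : 1 - Pr (@edge_prob 'I_n R p) xpred0 <= gnp_prob p (fun _ : graph 'I_n
  => True) <= 1.
  exact: (gnp_prob_bounds p0 p1).
rewrite ger0_norm; last by rewrite subr_ge0 (le_trans hi2).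
have le_exp : expR (- l) <= l^-1.
  rewrite expRN lef_pV2 ?posrE ?expR_gt0 //.
  by apply: le_trans (expR_ge1Dx l); rewrite lerDr.
have hz : (2 ^+ e + 4) * expR (- l) <= tau.
  have P0 : 0 <= 2 ^+ e + 4 :> R by rewrite addr_ge0 // exprn_ge0.
  apply: le_trans (ler_wpM2l P0 le_exp) _.
  by rewrite ler_pdivrMr // mulrC -ler_pdivrMr.
by rewrite lerBlDr -lerBlDl; apply: le_trans lo2; rewrite lerD2l lerN2.
Unshelve. all: by end_near. Qed.
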